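(* Let $n,d\ge1$, let $(\mathsf A,\mathcal A)$ be a standard Borel action space, let $\mathsf K\subseteq\Theta_\downarrow$ be nonempty, and let $\ell:\Theta_\downarrow\times\mathsf A\to[0,\infty]$ be a measurable (spectrum-only) loss. Define $$\mathfrak R_n^{\mathrm{all}}(\mathsf K;\ell):=\inf_{D_n}\sup_{\theta\in\mathsf K}\sup_{U\in U(d)}\int_{\mathsf A}\ell(\theta,a)\operatorname{Tr}\!\left[(U\operatorname{diag}(\theta)U^\dagger)^{\otimes n}D_n(da)\right],$$ where the infimum is over all action-valued POVMs $D_n$ on $(\mathbb C^d)^{\otimes n}$ with outcomes in $\mathsf A$, and $$\mathfrak R_n^{\mathrm{WSS}}(\mathsf K;\ell):=\inf_{\delta_n}\sup_{\theta\in\mathsf K}\sum_{\lambda\in\mathbb Y_{n,d}}P_\theta^{(n)}(\lambda)\int_{\mathsf A}\ell(\theta,a)\,\delta_n(\lambda,da),$$ where the infimum is over all Markov kernels $\delta_n$ from $\mathbb Y_{n,d}$ to $\mathsf A$. Then $$\mathfrak R_n^{\mathrm{all}}(\mathsf K;\ell)=\mathfrak R_n^{\mathrm{WSS}}(\mathsf K;\ell).$$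
   Context: $\Theta_\downarrow=\{\theta\in[0,1]^d:\theta_1\ge\dots\ge\theta_d,\ \sum_i\theta_i=1\}$. An action-valued POVM is a map from $\mathcal A$ to positive operators on $(\mathbb C^d)^{\otimes n}$, countably additive in the weak operator topology, with total mass $I$. $\mathbb Y_{n,d}$ is the set of partitions $\lambda=(\lambda_1\ge\dots\ge\lambda_d\ge0)$ of $n$. By Schur–Weyl duality $(\mathbb C^d)^{\otimes n}\cong\bigoplus_{\lambda\in\mathbb Y_{n,d}}\mathcal U_\lambda\otimes\mathcal V_\lambda$ with $\mathcal U_\lambda$, $\mathcal V_\lambda$ irreducible modules of $U(d)$ (acting by $U^{\otimes n}$) and $S_n$ (permuting factors); $\Pi_\lambda$ is the orthogonal projection onto the $\lambda$-block. $P_\theta^{(n)}(\lambda)=\operatorname{Tr}[\operatorname{diag}(\theta)^{\otimes n}\Pi_\lambda]$ is the weak Schur sampling law. *)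

(* Defs.v *)
From HB Require Import structures.
From mathcomp Require Import all_boot all_order all_algebra all_fingroup.
From mathcomp Require Import sesquilinear spectral mxrepresentation complex.
From mathcomp Require Import all_classical all_reals all_analysis.
From mathcomp Require Import measurable_realfun.

Set Implicit Arguments.
Unset Strict Implicit.
Unset Printing Implicit Defensive.

Import Order.TTheory GRing.Theory Num.Theory.
Import numFieldNormedType.Exports.

Local Open Scope classical_set_scope.
Local Open Scope ring_scope.
Local Open Scope complex_scope.
Local Open Scope sesquilinear_scope.

(* The tensor space (C^d)^{(x) n} is C^N with N = d ^ n, the coordinates being
   indexed, through [word], by the words w : {1..n} -> {1..d}; the basis
   vector of index w is e_(w 1) (x) ... (x) e_(w n). *)
Notation tdim n d := #|{ffun 'I_n -> 'I_d}|.

Definition word n d (i : 'I_(tdim n d)) : {ffun 'I_n -> 'I_d} := enum_val i.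

Section Tensor.
Context {R : realType}.

Definition tensor_pow n d (A : 'M[R[i]]_d) : 'M[R[i]]_(tdim n d) :=
  \matrix_(i, j) \prod_(k < n) A (word i k) (word j k).

(* [perm_factors s] acts on row vectors (the convention of mxrepresentation)
   and sends the basis vector of index w to the one of index w \o s^-1, i.e.
   it moves the k-th factor to position s k. *)
Definition perm_factors n d (s : 'S_n) : 'M[R[i]]_(tdim n d) :=
  \matrix_(i, j)
    (word j == [ffun k => word i ((s^-1)%g k)])%:R.

Lemma perm_factors_repr n d : mx_repr [set: 'S_n]%SET (@perm_factors n d).
Proof.
split=> [|s t _ _].
  apply/matrixP => i j; rewrite !mxE invg1 eq_sym.
  have -> : [ffun k => word i ((1%g : 'S_n) k)] = word i.
    by apply/ffunP => k; rewrite ffunE perm1.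
  by rewrite (inj_eq enum_val_inj).
apply/matrixP => i j; rewrite !mxE.
pose w : {ffun 'I_n -> 'I_d} := [ffun k => word i ((s^-1)%g k)].
rewrite (bigD1 (enum_rank w)) //= big1 ?addr0 => [|l /negPf l_neq]; last first.
  by rewrite mxE -(inj_eq enum_rank_inj) /word enum_valK l_neq mul0r.
rewrite !mxE /word enum_rankK eqxx mul1r; congr ((_ == _)%:R).
by apply/ffunP => k; rewrite !ffunE invMg permM.
Qed.

Canonical perm_factors_representation n d :=
  MxRepresentation (perm_factors_repr n d).

End Tensor.

(* Partitions of n into d parts, padded with zeros; each part is at most n, so
   storing the parts in 'I_n.+1 loses nothing. *)
Definition is_young n d (t : d.-tuple 'I_n.+1) : bool :=
  sorted geq [seq val i | i <- t] && (sumn [seq val i | i <- t] == n).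

Definition young n d := {t : d.-tuple 'I_n.+1 | is_young t}.

HB.instance Definition _ n d := Finite.on (young n d).

Definition parts n d (lam : young n d) : seq nat := [seq val i | i <- val lam].

Section YoungPointed.
Variables n d : nat.

Let one_row : d.+1.-tuple 'I_n.+1 := [tuple of ord_max :: nseq d ord0].

Let one_row_young : is_young one_row.
Proof.
rewrite /is_young /= map_nseq /= sumn_nseq mul0n addn0 eqxx andbT.
by elim: d n => [|m IH] k //=; rewrite IH.
Qed.

HB.instance Definition _ := isPointed.Build (young n d.+1)
  (exist (@is_young n d.+1) one_row one_row_young).

HB.instance Definition _ := @isMeasurable.Build default_measure_display
  (young n d.+1) discrete_measurable discrete_measurable0
  discrete_measurableC discrete_measurableU.

End YoungPointed.

Section Specht.
Context {R : realType} (n d : nat) (lam : young n d).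

(* The Young diagram of lam is filled row by row: the box holding k lies in row
   [reshape_index (parts lam) k] and column [reshape_offset (parts lam) k]. *)
Definition row_stab : {set 'S_n} :=
  [set s : 'S_n | [forall k,
    reshape_index (parts lam) (s k) == reshape_index (parts lam) k]]%SET.

Definition col_stab : {set 'S_n} :=
  [set s : 'S_n | [forall k,
    reshape_offset (parts lam) (s k) == reshape_offset (parts lam) k]]%SET.

Definition young_symmetrizer : 'rV[R[i]]_#|[set: 'S_n]%SET| :=
  \sum_(p in row_stab) \sum_(q in col_stab)
    (-1) ^+ q *: delta_mx 0 (gring_index [set: 'S_n]%G (p * q)%g).

(* The irreducible S_n-module V_lam: the ideal of the group algebra generated
   by the Young symmetrizer. *)
Definition specht_repr :=
  submod_repr (cyclic_mx_module (regular_repr R[i] [set: 'S_n]%G)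
                                young_symmetrizer).

(* The lam-block U_lam (x) V_lam of the Schur-Weyl decomposition is the
   V_lam-isotypic component of the tensor space, i.e. the sum of all its
   S_n-submodules isomorphic to V_lam. *)
Definition schur_weyl_block : set 'rV[R[i]]_(tdim n d) :=
  [set v | exists2 Ws : seq 'M[R[i]]_(tdim n d),
     {in Ws, forall W,
       exists modW : mxmodule (perm_factors_representation n d) W,
         mx_rsim (submod_repr modW) specht_repr} &
     (v <= \sum_(W <- Ws) W)%MS].

(* Operators act on column vectors, whence the transposes. *)
Definition is_orthogonal_projection N (V : set 'rV[R[i]]_N) (P : 'M[R[i]]_N) :=
  [/\ P ^t* = P, P *m P = P & forall v : 'rV_N, V v <-> P *m v^T = v^T].

Definition block_projection : 'M[R[i]]_(tdim n d) :=
  xget 0 [set P | is_orthogonal_projection schur_weyl_block P].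

End Specht.
Arguments block_projection R {n d} lam.

Section Decision.
Context {R : realType}.

Definition ordered_simplex d : set (d.-tuple R) :=
  [set th | [/\ forall i, 0 <= tnth th i <= 1,
                forall i j : 'I_d, (i <= j)%N -> tnth th j <= tnth th i &
                \sum_(i < d) tnth th i = 1]].

Definition diag_state d (th : d.-tuple R) : 'M[R[i]]_d :=
  diag_mx (\row_i (tnth th i)%:C).

Definition wss_law n d (th : d.-tuple R) (lam : young n d) : R :=
  complex.Re (\tr (tensor_pow n (diag_state th) *m block_projection R lam)).

Definition positive_operator N (M : 'M[R[i]]_N) :=
  forall v : 'cV[R[i]]_N, 0 <= (v ^t* *m M *m v) 0 0.

Context {dA : measure_display} (A : measurableType dA).

Definition standard_borel :=
  exists (X : completePseudoMetricType R) (f : A -> X),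
    [/\ hausdorff_space X,
        exists2 D : set X, countable D & dense D,
        bijective f &
        @measurable dA A = preimage_set_system setT f <<s @open X >>].

(* Only the values of a POVM on measurable sets are meaningful. *)
Definition is_povm N (D : set A -> 'M[R[i]]_N) :=
  [/\ forall B, measurable B -> positive_operator (D B),
      D setT = 1%:M &
      forall F : (set A)^nat, (forall k, measurable (F k)) ->
        trivIset setT F ->
        forall u v : 'cV[R[i]]_N,
          (fun m => \sum_(k < m) (u ^t* *m D (F k) *m v) 0 0 : R[i]^o) @ \oo
            --> ((u ^t* *m D (\bigcup_k F k) *m v) 0 0 : R[i]^o)].

(* The outcome law B |-> Tr[rho D(B)]; the trace is a nonnegative real when rho
   and D B are positive. *)
Definition povm_law N (D : set A -> 'M[R[i]]_N) (rho : 'M[R[i]]_N) (B : set A)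
  : \bar R := (complex.Re (\tr (rho *m D B)))%:E.

Local Open Scope ereal_scope.

Definition risk_all n d (K : set (d.-tuple R)) (l : d.-tuple R * A -> \bar R)
  : \bar R :=
  ereal_inf [set
    ereal_sup [set
      ereal_sup [set
        \int[povm_law D
               (tensor_pow n (U *m diag_state th *m U ^t*)%R)]_a l (th, a)
      | U in [set U : 'M[R[i]]_d | U \is unitarymx]]
    | th in K]
  | D in [set D : set A -> 'M[R[i]]_(tdim n d) | is_povm D]].

Definition risk_wss n d (K : set (d.+1.-tuple R))
  (l : d.+1.-tuple R * A -> \bar R) : \bar R :=
  ereal_inf [set
    ereal_sup [set
      \sum_(lam : young n d.+1)
        (wss_law th lam)%:E * \int[delta lam]_a l (th, a)
    | th in K]
  | delta in [set: R.-pker (young n d.+1) ~> A]].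

End Decision.
Arguments ordered_simplex R d : clear implicits.
Arguments standard_borel R {dA} A.

(* Main.v *)
From HB Require Import structures.
Require Import Defs.
From mathcomp Require Import all_boot all_order all_algebra all_fingroup.
From mathcomp Require Import pgroup sesquilinear spectral mxrepresentation complex.
From mathcomp Require Import all_classical all_reals all_analysis.
From mathcomp Require Import measurable_realfun.
From mathcomp Require Import zify ring lra.

Set Implicit Arguments.
Unset Strict Implicit.
Unset Printing Implicit Defensive.

Import Order.TTheory GRing.Theory Num.Theory.
Import numFieldNormedType.Exports.

(** A kernel [delta] yields the POVM [B |-> \sum_lam delta(lam, B) Pi_lam], whose risk does not
    depend on [U] because [Pi_lam] commutes with [U^(x)n].

    Conversely, given a POVM [D], let [X] be the point of least Hilbert-Schmidt norm in the closed
    convex hull of the orbit of [rho^(x)n] under the unitary group: it replaces the Haar average.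
    Uniqueness of [X] makes it commute with every [U^(x)n]. The identities satisfied by the [U^(x)n]
    extend from unitary to all matrices by polynomial continuation, and the [g^(x)n] span the
    commutant of S_n by polarization, so [X] commutes with this commutant as well as with S_n.
    Schur's lemma then gives [X = \sum_lam c_lam Pi_lam] with [c_lam = P_theta(lam) / Tr Pi_lam].
    Hence the kernel [B |-> Tr(Pi_lam D(B)) / Tr Pi_lam] integrates nonnegative simple functions,
    and so nonnegative measurable ones, to at most the supremum over [U].

    That the blocks of partitions with at most [d] parts exhaust the tensor space is a count:
    Specht modules are pairwise nonisomorphic simple modules, and there are as many of them as
    cycle types, hence at least as many as irreducible modules. *)

(** * Young diagrams *)

(** The hull of the orbit is described by its half-spaces: a bound on Re Tr(. A) valid on the whole
    orbit passes to [X] by definition, and an equality follows from the bounds for A and -A. Since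
    the integral of a simple function against a POVM is Re Tr(X L) for one operator L, a bound
    uniform in U is all that has to be transported.

    Shapes are compared through one number, the sum of the row indices of the boxes, in place of the
    dominance order. A filling by naturals that are distinct within each column has at least this
    sum, and equality makes it the filling by row indices up to a column permutation. This one fact
    yields both the simplicity of Specht modules and their pairwise inequivalence.

    The count of conjugacy classes calls for partitions with n parts, whereas blocks are indexed by
    d parts. The link is that antisymmetrizing more than d tensor positions gives zero, so only
    shapes with at most d rows occur in the tensor space; trailing zeros do not affect the module.

    Representations act on row vectors and operators on column vectors, so the central idempotents
    appear transposed in the block projections. *)

Section Diagram.
Variables (n d : nat) (lam : young n d).
Local Open Scope nat_scope.
Implicit Types (i j k : 'I_n).

Definition box_row k := reshape_index (parts lam) k.
Definition box_col k := reshape_offset (parts lam) k.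
(** Macdonald's n(lam): the sum over rows a, counted from 0, of a times the length of row a. *)
Definition row_weight := \sum_(k < n) box_row k.

Lemma sumn_parts : sumn (parts lam) = n.
Proof. by have := valP lam; rewrite /is_young => /andP[_ /eqP]. Qed.

Lemma sorted_parts : sorted geq (parts lam).
Proof. by have := valP lam; rewrite /is_young => /andP[]. Qed.

Lemma size_parts : size (parts lam) = d.
Proof. by rewrite size_map size_tuple. Qed.

Lemma nth_parts_anti a b : a <= b -> nth 0 (parts lam) b <= nth 0 (parts lam) a.
Proof.
move=> le_ab; have [ltb|geb] := ltnP b (size (parts lam)); last first.
  by rewrite nth_default.
apply: (@sorted_leq_nth _ geq _ _ 0 _ sorted_parts a b) => //.
- by move=> y x z; rewrite /geq /= => h1 h2; apply: leq_trans h2 h1.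
- by move=> x; rewrite /geq /=.
- by rewrite inE (leq_ltn_trans le_ab).
Qed.

Lemma box_inj i j : box_row i = box_row j -> box_col i = box_col j -> i = j.
Proof.
move=> er ec; apply: val_inj => /=.
by rewrite -(reshape_indexK (parts lam) i) -(reshape_indexK (parts lam) j);
   move: er ec; rewrite /box_row /box_col => -> ->.
Qed.

Lemma box_col_lt k : box_col k < nth 0 (parts lam) (box_row k).
Proof. by apply: reshape_offsetP; rewrite sumn_parts. Qed.

Lemma box_above k a : a <= box_row k ->
  exists2 j, box_row j = a & box_col j = box_col k.
Proof.
move=> le_a.
have lt_c : box_col k < nth 0 (parts lam) a.
  exact: leq_trans (box_col_lt k) (nth_parts_anti le_a).
have ltn : flatten_index (parts lam) a (box_col k) < n.
  by rewrite -[X in _ < X]sumn_parts flatten_indexP.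
exists (Ordinal ltn).
  by rewrite /box_row /= flatten_indexKl.
by rewrite {1}/box_col /= flatten_indexKr.
Qed.

Lemma card_box_row a : #|[set k | box_row k == a]%SET| = nth 0 (parts lam) a.
Proof.
have ltn (c : 'I_(nth 0 (parts lam) a)) : flatten_index (parts lam) a c < n.
  by rewrite -[X in _ < X]sumn_parts flatten_indexP.
pose f c := Ordinal (ltn c).
have f_inj : injective f.
  move=> c c' /(congr1 val) /= /eqP; rewrite /flatten_index eqn_add2l => /eqP.
  exact: val_inj.
rewrite -[RHS]card_ord -(card_imset _ f_inj); apply: eq_card => k.
rewrite inE; apply/eqP/imsetP => [rk|[c _ ->]]; last first.
  by rewrite /box_row /= flatten_indexKl.
have ltc : box_col k < nth 0 (parts lam) a by rewrite -rk box_col_lt.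
exists (Ordinal ltc) => //; apply: val_inj => /=.
by rewrite -rk /box_row /box_col reshape_indexK.
Qed.

Section Filling.
Variable w : 'I_n -> nat.
Hypothesis w_col_inj : forall i j, box_col i = box_col j -> w i = w j -> i = j.

(* Replacing each entry by its rank within its column permutes the row indices. *)
Let rank_in_col k := #|[set j | (box_col j == box_col k) && (w j < w k)]%SET|.

(** The entries of one column are distinct naturals, so at most [w k] of them lie below [w k]. *)
Let rank_le k : rank_in_col k <= w k.
Proof.
rewrite /rank_in_col; set S := [set j | _]%SET.
have lt_w (j : 'I_n) : j \in S -> w j < w k by rewrite inE => /andP[].
(* [inord] requires a successor, so the target has one extra element, [ord_max], which the image
   misses. *)
pose f (j : 'I_n) : 'I_(w k).+1 := inord (w j).
have f_inj : {in S &, injective f}.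
  move=> i j Si Sj /(congr1 val); rewrite /= !inordK ?ltnS ?(ltnW (lt_w _ _))//.
  move: Si Sj; rewrite !inE => /andP[/eqP ci _] /andP[/eqP cj _].
  by apply: w_col_inj; rewrite ci.
rewrite -(card_in_imset f_inj) -ltnS -[X in _ < X](card_ord (w k).+1).
rewrite -cardsT; apply: proper_card; apply/properP; split; first exact: finset.subsetT.
exists ord_max; rewrite ?inE //; apply/imsetP => -[j Sj /(congr1 val)] /=.
by rewrite inordK ?ltnS ?(ltnW (lt_w _ _))// => e; have := lt_w _ Sj; rewrite -e ltnn.
Qed.

(** A column has no gaps: if it missed row m, all its boxes would lie in rows of index below m and
    there would be at most m of them. But the rank is smaller than the number of boxes in the
    column. *)
Let rank_box k : exists j,
  (box_row j == rank_in_col k) && (box_col j == box_col k).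
Proof.
pose S := [set j | box_col j == box_col k]%SET.
have rS : rank_in_col k < #|S|.
  apply: proper_card; apply/properP; split.
    by apply/fintype.subsetP => j; rewrite !inE => /andP[].
  by exists k; rewrite !inE ?eqxx ?ltnn.
have [|no] := pselect (exists j, (box_row j == rank_in_col k) && (box_col j == box_col k)) => //.
exfalso; set m := rank_in_col k in rS no *.
have ltm j : j \in S -> box_row j < m.
  rewrite inE => /eqP cj; rewrite ltnNge; apply/negP => /box_above[i ri ci].
  by apply: no; exists i; rewrite ri ci cj !eqxx.
have [m0|m_gt0] := posnP m.
  have /card_gt0P[j /ltm] : 0 < #|S| by exact: leq_ltn_trans rS.
  by rewrite m0.
case: m => // m in rS no ltm m_gt0 *.
pose f (j : 'I_n) : 'I_m.+1 := inord (box_row j).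
have f_inj : {in S &, injective f}.
  move=> i j Si Sj /(congr1 val); rewrite /= !inordK ?ltm//.
  by move: Si Sj; rewrite !inE => /eqP ci /eqP cj e; apply: box_inj; rewrite ?ci.
by have := max_card (f @: S)%SET; rewrite card_in_imset // card_ord leqNgt rS.
Qed.

Let shuffle k : 'I_n := xchoose (rank_box k).

Let shuffleP k : box_row (shuffle k) = rank_in_col k /\ box_col (shuffle k) = box_col k.
Proof. by have /andP[/eqP -> /eqP ->] := xchooseP (rank_box k). Qed.

Let shuffle_inj : injective shuffle.
Proof.
move=> i j e.
have [ri ci] := shuffleP i; have [rj cj] := shuffleP j.
rewrite e in ri ci; have {ci}cij : box_col i = box_col j by rewrite -ci cj.
have {ri} rij : rank_in_col i = rank_in_col j by rewrite -ri rj.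
have lt a b : box_col a = box_col b -> w a < w b -> rank_in_col a < rank_in_col b.
  move=> cab lt_w; apply: proper_card; apply/properP; split.
    apply/fintype.subsetP => x; rewrite !inE => /andP[/eqP -> /ltn_trans ->] //.
    by rewrite cab eqxx.
  by exists a; rewrite !inE ?cab ?eqxx ?ltnn.
apply: w_col_inj => //; case: (ltngtP (w i) (w j)) => // [/(lt _ _ cij)|/(lt _ _ (esym cij))];
  by rewrite rij ltnn.
Qed.

Let sum_rank : \sum_(k < n) rank_in_col k = row_weight.
Proof.
rewrite /row_weight [RHS](reindex_inj shuffle_inj) /=.
by apply: eq_bigr => k _; rewrite (shuffleP k).1.
Qed.

Lemma row_weight_min : row_weight <= \sum_(k < n) w k.
Proof. by rewrite -sum_rank; apply: leq_sum => k _. Qed.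

(** Equality of the sums forces [w] to coincide with the rank at every box, and [shuffle] is then
    the column permutation sought. *)
Lemma row_weight_min_eq : \sum_(k < n) w k = row_weight ->
  exists2 q : 'S_n, (forall k, box_col (q k) = box_col k) &
    forall k, w k = box_row (q k).
Proof.
rewrite -sum_rank => e.
have ew k : w k = rank_in_col k.
  apply/eqP; rewrite eqn_leq rank_le andbT -subn_eq0.
  have : \sum_(k < n) (w k - rank_in_col k) = 0.
    by rewrite sumnB ?e ?subnn// => j _; exact: rank_le.
  by move/eqP; rewrite sum_nat_eq0 => /forallP/(_ k).
exists (perm shuffle_inj) => k; rewrite permE; have [] := shuffleP k => //.
by move=> -> _; rewrite ew.
Qed.

End Filling.
End Diagram.

Lemma young_eq_card n d (lam mu : young n d) :
  (forall a, #|[set k | box_row lam k == a]%SET| = #|[set k | box_row mu k == a]%SET|) ->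
  lam = mu.
Proof.
move=> e; apply: val_inj; apply: val_inj => /=.
apply: (inj_map (@ord_inj _)); apply: (@eq_from_nth _ 0%N).
  by rewrite -!/(parts _) !size_parts.
by move=> a _; rewrite -!/(parts _) -!card_box_row e.
Qed.

(** * Young symmetrizers and Specht modules *)

Section YoungOperators.
Local Open Scope ring_scope.
Local Open Scope complex_scope.
Variables (R : realType) (n : nat).
Local Notation F := R[i].
Local Notation G := [set: 'S_n]%G.

Lemma pchar_complex_group : [pchar F]^'.-group%g G.
Proof. by apply/pgroupP => p _; rewrite inE /= pchar_num. Qed.

(** The projection along an invariant complement. Since it commutes with the group, an operator
    commuting with the whole commutant preserves [U]. *)
Lemma maschke_projection m (rG : mx_representation F G m) (U : 'M[F]_m) :
  mxmodule rG U -> exists P : 'M[F]_m,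
  [/\ (P <= U)%MS, U *m P = U & forall x, P *m rG x = rG x *m P].
Proof.
move=> modU.
have [W modW defV dxUW] := mx_Maschke_pchar rG pchar_complex_group modU (submx1 U).
have dx := mxdirect_addsP dxUW.
exists (proj_mx U W); split; first by have := proj_mx_sub U W 1%:M; rewrite mul1mx.
  exact: proj_mx_id.
move=> x; have /hom_mxP : (1%:M <= dom_hom_mx rG (proj_mx U W))%MS.
  by rewrite -defV proj_mx_hom.
by move=> /(_ x (finset.in_setT x)); rewrite !mul1mx.
Qed.

Section Operators.
Variables (d : nat) (lam : young n d).

Section InRepresentation.
Variables (m : nat) (rG : mx_representation F G m).

(** The two halves of the Young symmetrizer are evaluated in an arbitrary representation, because
    the same element acts on the regular module, on Specht modules and on tensors. *)
Definition row_op : 'M[F]_m := \sum_(p in row_stab lam) rG p.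
Definition col_op : 'M[F]_m := \sum_(q in col_stab lam) (-1) ^+ q *: rG q.
Definition young_op := row_op *m col_op.

Let reprM (x y : 'S_n) : rG (x * y)%g = rG x *m rG y.
Proof. by rewrite repr_mxM ?inE. Qed.

Lemma mem_row_stab (s : 'S_n) :
  reflect (forall k, box_row lam (s k) = box_row lam k) (s \in row_stab lam).
Proof. by rewrite inE; apply: (iffP forallP) => h k; apply/eqP/h. Qed.

Lemma mem_col_stab (s : 'S_n) :
  reflect (forall k, box_col lam (s k) = box_col lam k) (s \in col_stab lam).
Proof. by rewrite inE; apply: (iffP forallP) => h k; apply/eqP/h. Qed.

Lemma row_stabM (s t : 'S_n) : s \in row_stab lam ->
  ((s * t)%g \in row_stab lam) = (t \in row_stab lam).
Proof.
move=> /mem_row_stab hs; apply/mem_row_stab/mem_row_stab => ht k.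
  by rewrite -(permKV s k) -permM ht hs.
by rewrite permM ht hs.
Qed.

Lemma col_stabM (s t : 'S_n) : s \in col_stab lam ->
  ((s * t)%g \in col_stab lam) = (t \in col_stab lam).
Proof.
move=> /mem_col_stab hs; apply/mem_col_stab/mem_col_stab => ht k.
  by rewrite -(permKV s k) -permM ht hs.
by rewrite permM ht hs.
Qed.

Lemma col_stabMr (s t : 'S_n) : t \in col_stab lam ->
  ((s * t)%g \in col_stab lam) = (s \in col_stab lam).
Proof.
move=> /mem_col_stab ht; apply/mem_col_stab/mem_col_stab => hs k.
  by rewrite -[RHS]hs permM ht.
by rewrite permM ht hs.
Qed.

Lemma row_stabMr (s t : 'S_n) : t \in row_stab lam ->
  ((s * t)%g \in row_stab lam) = (s \in row_stab lam).
Proof.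
move=> /mem_row_stab ht; apply/mem_row_stab/mem_row_stab => hs k.
  by rewrite -[RHS]hs permM ht.
by rewrite permM ht hs.
Qed.

Lemma row_opMr (t : 'S_n) : t \in row_stab lam -> row_op *m rG t = row_op.
Proof.
move=> ht; rewrite /row_op mulmx_suml [RHS](reindex_inj (mulIg t)) /=.
by apply: eq_big => [s|s _]; rewrite ?row_stabMr ?reprM.
Qed.

Lemma row_opMl (t : 'S_n) : t \in row_stab lam -> rG t *m row_op = row_op.
Proof.
move=> ht; rewrite /row_op mulmx_sumr [RHS](reindex_inj (mulgI t)) /=.
by apply: eq_big => [s|s _]; rewrite ?row_stabM ?reprM.
Qed.

Lemma col_opMl (t : 'S_n) : t \in col_stab lam ->
  rG t *m col_op = (-1) ^+ t *: col_op.
Proof.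
move=> ht; rewrite /col_op mulmx_sumr [in RHS](reindex_inj (mulgI t)) /= scaler_sumr.
apply: eq_big => [s|s _]; rewrite ?col_stabM // reprM -scalemxAr scalerA.
by rewrite odd_permM signr_addb mulrA -signr_addb addbb mul1r.
Qed.

Lemma col_opMr (t : 'S_n) : t \in col_stab lam ->
  col_op *m rG t = (-1) ^+ t *: col_op.
Proof.
move=> ht; rewrite /col_op mulmx_suml [in RHS](reindex_inj (mulIg t)) /= scaler_sumr.
apply: eq_big => [s|s _]; rewrite ?col_stabMr // reprM -scalemxAl scalerA.
by rewrite odd_permM signr_addb mulrCA -signr_addb addbb mulr1.
Qed.

Lemma gring_mx_delta (x : 'S_n) :
  gring_mx rG (delta_mx 0 (gring_index G x)) = rG x.
Proof. by rewrite /gring_mx /= -rowE rowK mxvecK gring_indexK ?inE. Qed.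

Lemma gring_mx_young : gring_mx rG (young_symmetrizer lam) = young_op.
Proof.
rewrite /young_symmetrizer raddf_sum /young_op /row_op mulmx_suml /=.
apply: eq_bigr => p _; rewrite raddf_sum /= /col_op mulmx_sumr; apply: eq_bigr => q _.
by rewrite linearZ -scalemxAr -reprM; congr (_ *: _); exact: gring_mx_delta.
Qed.

End InRepresentation.
End Operators.

(** * Pairs of shapes *)

Section TwoShapes.
Variables (d : nat) (mu lam : young n d) (m : nat) (rG : mx_representation F G m).

(** The condition in von Neumann's lemma on pairs of tableaux, here with fixed fillings of [mu] and
    [lam] related by [g]. *)
Definition separates (g : 'S_n) := forall i j : 'I_n,
  box_row mu i = box_row mu j -> box_col lam (g i) = box_col lam (g j) -> i = j.

Let reprM (x y : 'S_n) : rG (x * y)%g = rG x *m rG y.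
Proof. by rewrite repr_mxM ?inE. Qed.

Let self_opp_eq0 (A : 'M[F]_m) : A = - A -> A = 0.
Proof.
move=> e; apply/eqP; have /eqP : A *+ 2 = 0 by rewrite mulr2n {1}e addNr.
by rewrite -scaler_nat scaler_eq0 pnatr_eq0.
Qed.

Let tperm_row i j : box_row mu i = box_row mu j -> tperm i j \in row_stab mu.
Proof. by move=> e; apply/mem_row_stab => k; case: tpermP => // ->. Qed.

Let tperm_col i j : box_col lam i = box_col lam j -> tperm i j \in col_stab lam.
Proof. by move=> e; apply/mem_col_stab => k; case: tpermP => // ->. Qed.

(** If two boxes of a row of [mu] go to one column of [lam], their transposition is absorbed by the
    row operator with sign +1; moved across [g] it becomes a transposition absorbed by the column
    operator with sign -1. The product then equals its own opposite. *)
Lemma row_col_op_separates (g : 'S_n) :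
  row_op mu rG *m rG g *m col_op lam rG != 0 -> separates g.
Proof.
move=> nz i j er ec; apply/eqP; apply: contraNT nz => ij; apply/eqP/self_opp_eq0.
rewrite -{1}(row_opMr rG (tperm_row er)) -(mulmxA (row_op _ _)) -reprM.
have -> : (tperm i j * g = g * tperm (g i) (g j))%g.
  by rewrite -tpermJ conjgC.
rewrite reprM -!mulmxA col_opMl ?tperm_col // odd_tperm (inj_eq perm_inj) ij.
by rewrite expr1 scaleN1r !mulmxN.
Qed.

(** The same sign argument in the order in which the halves meet inside a product of two Young
    symmetrizers. *)
Lemma col_row_op_separates (g : 'S_n) :
  col_op lam rG *m rG g^-1%g *m row_op mu rG != 0 -> separates g.
Proof.
move=> nz i j er ec; apply/eqP; apply: contraNT nz => ij; apply/eqP/self_opp_eq0.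
rewrite -{1}(row_opMl rG (tperm_row er)) mulmxA -(mulmxA (col_op _ _)) -reprM.
have -> : (g^-1 * tperm i j = tperm (g i) (g j) * g^-1)%g.
  by rewrite -tpermJ conjgE -!mulgA mulgV mulg1.
rewrite reprM !mulmxA col_opMr ?tperm_col // odd_tperm (inj_eq perm_inj) ij.
by rewrite expr1 scaleN1r !mulNmx.
Qed.

(** Read as a filling of [lam] by row indices of [mu], this is the hypothesis of the minimality of
    [row_weight]. *)
Lemma separates_inj g : separates g -> forall i j, box_col lam i = box_col lam j ->
  box_row mu (g^-1%g i) = box_row mu (g^-1%g j) -> i = j.
Proof.
move=> sep i j ec er; apply: (@perm_inj _ g^-1%g); apply: sep => //.
by rewrite !permKV.
Qed.

Lemma sum_box_row (g : 'S_n) :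
  (\sum_(k < n) box_row mu (g k) = row_weight mu)%N.
Proof. by rewrite /row_weight [RHS](reindex_inj (@perm_inj _ g)). Qed.

Lemma separates_row_weight g : separates g -> (row_weight lam <= row_weight mu)%N.
Proof. by move/separates_inj/row_weight_min; rewrite sum_box_row. Qed.

Lemma separates_row_weight_eq g : separates g -> row_weight lam = row_weight mu ->
  exists2 q : 'S_n, q \in col_stab lam &
    forall k, box_row mu (g^-1%g k) = box_row lam (q k).
Proof.
move=> /separates_inj/row_weight_min_eq h e.
by have [|q qc qr] := h; [rewrite sum_box_row|exists q => //; apply/mem_col_stab].
Qed.

(** Row lengths are sizes of level sets of the row function, and [g] and [q^-1] carry the level sets
    for the two shapes onto the same sets. *)
Lemma separates_shape g : separates g -> row_weight lam = row_weight mu -> mu = lam.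
Proof.
move=> sep e; have [q _ hq] := separates_row_weight_eq sep e.
apply: young_eq_card => a.
rewrite -(card_imset _ (@perm_inj _ g)) -[RHS](card_imset _ (@perm_inj _ q^-1%g)).
apply: eq_card => k.
rewrite -[in LHS](permKV g k) -[in RHS](permK q k) !mem_imset; try exact: perm_inj.
by rewrite !inE hq.
Qed.

End TwoShapes.

(** * Simplicity of Specht modules *)

Section Specht.
Variables (d : nat) (lam : young n d).
Local Notation aG := (regular_repr F G).
Local Notation c := (@young_symmetrizer R n d lam).

(** A nonzero product makes [g] separate [lam] from itself. The two weights being equal, some column
    permutation [q] makes [g * q] a row permutation, so [g] factors as row times column and is
    absorbed up to sign. *)
Lemma row_group_col_op m (rG : mx_representation F G m) (g : 'S_n) :
  exists a : F, row_op lam rG *m rG g *m col_op lam rG = a *: young_op lam rG.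
Proof.
have [->|/row_col_op_separates sep] := eqVneq (row_op lam rG *m rG g *m col_op lam rG) 0.
  by exists 0; rewrite scale0r.
have [q hq hr] := separates_row_weight_eq sep erefl.
have hp : (g * q)%g \in row_stab lam.
  by apply/mem_row_stab => k; rewrite permM -hr permK.
exists ((-1) ^+ q); have -> : (g = (g * q) * q^-1)%g by rewrite mulgK.
have hq' : q^-1%g \in col_stab lam.
  by rewrite -(col_stabM _ hq) mulgV; apply/mem_col_stab => k; rewrite perm1.
rewrite repr_mxM ?inE // mulmxA row_opMr // -mulmxA col_opMl // -scalemxAr.
by rewrite odd_permV.
Qed.

Lemma row_envelop_col_op m (rG : mx_representation F G m) (A : 'M[F]_m) :
  (A \in enveloping_algebra_mx rG)%MS ->
  exists a : F, row_op lam rG *m A *m col_op lam rG = a *: young_op lam rG.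
Proof.
move=> /envelop_mxP[a ->].
have /choice[b hb] := row_group_col_op rG.
exists (\sum_(x in G) a x * b x).
move: (row_op _ _) (col_op _ _) hb => r c hb; rewrite mulmx_sumr mulmx_suml scaler_suml.
apply: eq_bigr => x _; rewrite -scalemxAr -scalemxAl hb scalerA //.
Qed.

Lemma row_op_envelop m (rG : mx_representation F G m) :
  (row_op lam rG \in enveloping_algebra_mx rG)%MS.
Proof. by rewrite /row_op linear_sum summx_sub // => x _; rewrite envelop_mx_id ?inE. Qed.

Lemma col_op_envelop m (rG : mx_representation F G m) :
  (col_op lam rG \in enveloping_algebra_mx rG)%MS.
Proof.
rewrite /col_op linear_sum summx_sub // => x _; rewrite linearZ scalemx_sub //.
by rewrite envelop_mx_id ?inE.
Qed.

Lemma young_op_envelop m (rG : mx_representation F G m) :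
  (young_op lam rG \in enveloping_algebra_mx rG)%MS.
Proof. by rewrite envelop_mxM ?row_op_envelop ?col_op_envelop. Qed.

(** The coefficient of the identity is 1: a row permutation whose inverse is a column permutation
    fixes every box. *)
Lemma young_symmetrizer_neq0 : c != 0.
Proof.
apply/eqP => /(congr1 (fun v : 'rV_ _ => v 0 (gring_index G 1%g))) /eqP.
rewrite mxE /young_symmetrizer summxE (bigD1 1%g) /=; last first.
  by apply/mem_row_stab => k; rewrite perm1.
have E (p q : 'S_n) : (delta_mx 0 (gring_index G (p * q)%g) : 'rV[F]_#|G|)
    0 (gring_index G 1%g) = (q == p^-1%g)%:R.
  rewrite mxE eqxx /=; congr (_%:R); congr (nat_of_bool _).
  rewrite (inj_in_eq (can_in_inj (@gring_indexK _ G))) ?inE // eq_sym.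
  by rewrite -(inj_eq (mulgI p^-1%g)) mulKg mulg1.
rewrite [X in X + _]summxE (bigD1 1%g) /=; last first.
  by apply/mem_col_stab => k; rewrite perm1.
rewrite mxE E invg1 eqxx odd_perm1 mulr1 !big1 ?addr0 ?oner_eq0 //.
  move=> p /andP[pr p1]; rewrite summxE big1 // => q qc; rewrite mxE E.
  case: eqP => [eq|_]; last by rewrite mulr0.
  case/eqP: p1; apply/permP => k; rewrite perm1; apply: (@box_inj _ _ lam).
    exact: (mem_row_stab _ _ pr).
  rewrite -[in RHS](permK p k) -eq; apply/esym.
  exact: (mem_col_stab _ _ qc).
by move=> q /andP[_ /negPf q1]; rewrite mxE E invg1 q1 mulr0.
Qed.

(** An element of the group algebra is the image of the identity under right multiplication by it;
    this passes from vectors of the ideal to operators. *)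
Lemma young_symmetrizer_row : c = row (gring_index G 1%g) (young_op lam aG).
Proof. by rewrite -gring_mx_young -[LHS](gring_mxK (G := G)). Qed.

Local Notation U := (cyclic_mx aG c).

(** A vector of the ideal is c A with c = a b, the row half times the column half, and c A c = a (b
    A a) b is a multiple of a b by [row_envelop_col_op]. *)
Lemma specht_mul_young_op (v : 'rV_ _) : (v <= U)%MS ->
  exists a : F, v *m young_op lam aG = a *: c.
Proof.
move=> /cyclic_mxP[A EA ->].
have [a ha] : exists a : F, row_op lam aG *m (col_op lam aG *m A *m row_op lam aG)
  *m col_op lam aG = a *: young_op lam aG.
  by apply: row_envelop_col_op; rewrite !envelop_mxM ?row_op_envelop ?col_op_envelop.
exists a; rewrite young_symmetrizer_row -!row_mul.
have -> : young_op lam aG *m A *m young_op lam aG = a *: young_op lam aG.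
  by rewrite -ha /young_op !mulmxA.
by apply/rowP => j; rewrite !mxE.
Qed.

(* A right ideal killed by the symmetrizer squares to zero, whereas Maschke's theorem
   generates it by an idempotent. *)
Lemma specht_young_op_neq0 (W : 'M[F]_#|G|) : mxmodule aG W -> (W <= U)%MS -> W != 0 ->
  W *m young_op lam aG != 0.
Proof.
move=> modW WU; apply: contraNneq => Wc0.
have [P [PW WP cP]] := maschke_projection modW.
apply/eqP/row_matrixP => i; rewrite row0 -{1}WP row_mul; set w := row i W.
have /cyclic_mxP[A EA ew] : (w <= U)%MS by exact: submx_trans (row_sub _ _) WU.
have -> : w = row (gring_index G 1%g) (young_op lam aG *m A).
  by rewrite row_mul -young_symmetrizer_row.
have cE (B : 'M[F]_#|G|) : (B \in enveloping_algebra_mx aG)%MS -> B *m P = P *m B.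
  move=> /envelop_mxP[b ->]; rewrite mulmx_sumr mulmx_suml.
  by apply: eq_bigr => x _; rewrite -scalemxAl -scalemxAr cP.
rewrite -row_mul cE; last exact: (envelop_mxM (young_op_envelop _) EA).
rewrite mulmxA !row_mul; have /submxP[D ->] := PW.
by rewrite row_mul -(mulmxA (row _ D)) Wc0 mulmx0 mul0mx.
Qed.

(** A nonzero submodule contains some w with w c nonzero. This vector is a multiple of c, so the
    submodule contains the generator c. *)
Lemma specht_simple : mxsimple aG U.
Proof.
split; first exact: cyclic_mx_module.
  by rewrite cyclic_mx_eq0 young_symmetrizer_neq0.
move=> W modW WU nzW; have := specht_young_op_neq0 modW WU nzW.
case/matrix0Pn => i [j nz]; pose w := row i W.
have [a ha] := specht_mul_young_op (submx_trans (row_sub i W) WU).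
apply: cyclic_mx_sub => //.
have nza : a != 0.
  apply: contraNneq nz => a0; move: ha; rewrite a0 scale0r -row_mul.
  by move=> /rowP/(_ j); rewrite !mxE => ->.
rewrite -[c](scalerK nza) -ha; apply: scalemx_sub.
exact: (mxmodule_envelop modW (young_op_envelop _) (row_sub i W)).
Qed.

Lemma specht_irr : mx_irreducible (specht_repr (R := R) lam).
Proof. by apply/submod_mx_irr; exact: specht_simple. Qed.

End Specht.

(** * Inequivalence of Specht modules *)

Section Recognition.
Variables (d : nat).

Lemma rsim_young_op m1 m2 (r1 : mx_representation F G m1)
    (r2 : mx_representation F G m2) (lam : young n d) :
  mx_rsim r1 r2 -> young_op lam r1 = 0 -> young_op lam r2 = 0.
Proof.
move=> /mx_rsim_sym/mx_rsim_def[B [B' BB' h]] z.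
have E (T : finType) (P : pred T) (b : T -> F) (e : T -> 'S_n) :
    \sum_(x | P x) b x *: r2 (e x) = B *m (\sum_(x | P x) b x *: r1 (e x)) *m B'.
  rewrite mulmx_sumr mulmx_suml; apply: eq_bigr => x _.
  by rewrite h ?inE // -scalemxAr -scalemxAl.
have E1 : row_op lam r2 = B *m row_op lam r1 *m B'.
  have := E _ (mem (row_stab lam)) (fun=> 1) id.
  by under eq_bigr do rewrite scale1r; under [in RHS]eq_bigr do rewrite scale1r.
rewrite /young_op E1 /col_op E -!mulmxA (mulmxA B') BB' mul1mx.
by rewrite (mulmxA (row_op _ _)) -/(col_op lam r1) -/(young_op lam r1) z !(mul0mx, mulmx0).
Qed.

Lemma val_submod_young_op m (rG : mx_representation F G m) (U : 'M[F]_m)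
    (modU : mxmodule rG U) (lam : young n d) k (V : 'M[F]_(k, \rank U)) :
  val_submod (V *m young_op lam (submod_repr modU)) = val_submod V *m young_op lam rG.
Proof.
have E (T : finType) (P : pred T) (b : T -> F) (e : T -> 'S_n) (V' : 'M[F]_(k, \rank U)) :
   val_submod (V' *m \sum_(x | P x) b x *: submod_repr modU (e x)) =
   val_submod V' *m (\sum_(x | P x) b x *: rG (e x)).
  rewrite !mulmx_sumr linear_sum /=; apply: eq_bigr => x _.
  by rewrite -!scalemxAr linearZ /= -(val_submodJ modU) ?inE.
rewrite /young_op !mulmxA E; congr (_ *m _).
have := E _ (mem (row_stab lam)) (fun=> 1) id V.
by under eq_bigr do rewrite scale1r; under [in RHS]eq_bigr do rewrite scale1r.
Qed.

Lemma young_op_specht_neq0 (lam : young n d) :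
  young_op lam (specht_repr (R := R) lam) != 0.
Proof.
have modU := cyclic_mx_module (regular_repr F G) (young_symmetrizer lam).
have [_ nzU _] := specht_simple lam.
have := specht_young_op_neq0 modU (submx_refl _) nzU.
apply: contraNneq => z; set U := cyclic_mx _ _ in modU nzU *.
have /submxP[D ->] : (U <= val_submod (1%:M : 'M[F]_(\rank U)))%MS.
  by rewrite val_submod1.
rewrite -mulmxA -(val_submod_young_op (cyclic_mx_module _ _)).
by rewrite -/(specht_repr lam) mul1mx z linear0 mulmx0.
Qed.

(** The symmetrizer of [mu] does not kill its own Specht module, hence not that of [lam]. In the
    product of the two symmetrizers, the column half of [lam] meets the row half of [mu] across some
    group algebra element, so for some group element this middle part is nonzero. *)
Lemma specht_rsim_separates (lam mu : young n d) :
  mx_rsim (specht_repr (R := R) lam) (specht_repr mu) ->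
  exists g, separates mu lam g.
Proof.
move=> simLM; have /eqP nz := young_op_specht_neq0 mu.
suff [g hg] : exists g : 'S_n, col_op lam (regular_repr F G) *m
    regular_repr F G g *m row_op mu (regular_repr F G) != 0.
  by exists g^-1%g; apply: (@col_row_op_separates _ _ _ _ (regular_repr F G)); rewrite invgK.
apply: contrapT => no; apply: nz; apply: (rsim_young_op simLM).
have {}no (A : 'M[F]_#|G|) : (A \in enveloping_algebra_mx (regular_repr F G))%MS ->
    col_op lam (regular_repr F G) *m A *m row_op mu (regular_repr F G) = 0.
  move=> /envelop_mxP[a ->]; move: (row_op _ _) (col_op _ _) no => r c no.
  rewrite mulmx_sumr mulmx_suml big1 // => x _.
  rewrite -scalemxAr -scalemxAl; apply/eqP; rewrite scaler_eq0 orbC.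
  by apply/orP; left; apply/negPn/negP => nz; apply: no; exists x.
have modU := cyclic_mx_module (regular_repr F G) (young_symmetrizer lam).
set U := cyclic_mx _ _ in modU.
apply: (@val_submod_inj _ _ U).
rewrite -[young_op _ _ as X in val_submod X]mul1mx val_submod_young_op linear0.
apply/row_matrixP => i; rewrite row0 row_mul.
have : (row i (val_submod (1%:M : 'M[F]_(\rank U))) <= U)%MS.
  exact: submx_trans (row_sub _ _) (val_submodP _).
move=> /cyclic_mxP[A EA ->]; rewrite young_symmetrizer_row -!row_mul.
suff -> : young_op lam (regular_repr F G) *m A *m young_op mu (regular_repr F G) = 0.
  by rewrite row0.
rewrite /young_op mulmxA -(mulmxA (row_op lam _)) -(mulmxA (row_op lam _)).
by rewrite no // !(mulmx0, mul0mx).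
Qed.

(** Separation in both directions makes the row weights equal, and the equality case identifies the
    shapes. *)
Lemma specht_rsim_inj (lam mu : young n d) :
  mx_rsim (specht_repr (R := R) lam) (specht_repr mu) -> lam = mu.
Proof.
move=> sim; have [g hg] := specht_rsim_separates sim.
have [h hh] := specht_rsim_separates (mx_rsim_sym sim).
apply/esym; apply: (separates_shape hg); apply/eqP.
by rewrite eqn_leq (separates_row_weight hg) (separates_row_weight hh).
Qed.

End Recognition.
End YoungOperators.

(** * Irreducible representations of the symmetric group *)

Section CycleType.
Local Open Scope nat_scope.
Local Open Scope group_scope.
Variable T : finType.
Implicit Types (s t : {perm T}) (x y : T).

(** The criterion involves only the length of the cycle, so it transfers equalities between cycles
    of equal length of two permutations. *)
Lemma porbit_expE s x a b :
  ((s ^+ a) x == (s ^+ b) x) = (a == b %[mod #|porbit s x|])%N.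
Proof.
set m := #|porbit s x|.
have m_gt0 : (0 < m)%N by rewrite lt0n card_porbit_neq0.
have perK k : (s ^+ (k * m)) x = x.
  by elim: k => [|k IH]; rewrite ?perm1 // mulSn expgD permM [(s ^+ m) x]permX iter_porbit IH.
have redm c : (s ^+ c) x = (s ^+ (c %% m)%N) x.
  by rewrite {1}(divn_eq c m) expgD permM perK.
rewrite (redm a) (redm b); have := ltn_pmod a m_gt0; have := ltn_pmod b m_gt0.
move: (a %% m)%N (b %% m)%N => {redm}i j lt_j lt_i.
have := uniq_traject_porbit s x; rewrite -/m => u.
have sz := size_traject s x m.
have := nth_uniq x _ _ u; rewrite sz => /(_ i j lt_i lt_j).
by rewrite !nth_traject // !permX.
Qed.

Definition cycle_type s := [seq #|B| | B : {set T} <- enum (porbits s)].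

(* On each cycle of [s] a conjugating map is fixed by the choice of a
   representative and of a starting point on a cycle of [t] of equal length. *)
Lemma cycle_type_conj s t : perm_eq (cycle_type s) (cycle_type t) ->
  exists g : {perm T}, t = s ^ g.
Proof.
case: (pickP (fun _ : T => true)) => [x0 _|no _]; last first.
  by exists 1; apply/permP => x; have := no x.
case/(perm_iotaP 0%N) => Is eqI def_s.
set Et := enum (porbits t); set Es := enum (porbits s).
have szI : size Is = size Es by rewrite -(size_map (fun B : {set T} => #|B|)) -/(cycle_type s) def_s size_map.
(* [Is] gives, for each cycle of [s], the position of a cycle of [t] of the same length; [phi] is
   the resulting matching of cycles. *)
pose phi (B : {set T}) := nth finset.set0 Et (nth 0%N Is (index B Es)).
have uI : uniq Is by rewrite (perm_uniq eqI) iota_uniq.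
have ltI i : (i < size Is)%N -> (nth 0%N Is i < size Et)%N.
  move=> lti; have : nth 0%N Is i \in Is by rewrite mem_nth.
  by rewrite (perm_mem eqI) mem_iota size_map.
have idx B : B \in porbits s -> (index B Es < size Is)%N.
  by rewrite szI index_mem mem_enum.
have phiP B : B \in porbits s -> phi B \in porbits t.
  by move=> hB; rewrite -mem_enum mem_nth // ltI ?idx.
have phi_card B : B \in porbits s -> #|phi B| = #|B|.
  move=> hB; have lti := idx _ hB.
  have := congr1 (fun u => nth 0%N u (index B Es)) def_s.
  rewrite (nth_map 0%N) // /cycle_type (nth_map finset.set0) -?szI // nth_index ?mem_enum // => ->.
  by rewrite (nth_map finset.set0) // ltI.
have phi_inj : {in porbits s &, injective phi}.
  move=> B B' hB hB' /eqP; rewrite nth_uniq ?enum_uniq ?ltI ?idx //.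
  rewrite nth_uniq ?idx // => /eqP e.
  by rewrite -(nth_index finset.set0 (s := Es) (x := B)) ?mem_enum // e nth_index ?mem_enum.
have orb x : porbit s x \in porbits s by apply/imsetP; exists x.
pose rep (B : {set T}) := odflt x0 [pick z in B].
have repP u x : porbit u (rep (porbit u x)) = porbit u x.
  rewrite /rep; case: pickP => [z|/(_ x)] /=; last by rewrite porbit_id.
  by move=> hz; apply/eqP; rewrite eq_porbit_mem.
have /choice[e he] : forall x, exists i, (s ^+ i) (rep (porbit s x)) = x.
  move=> x; have /porbitP[i hi] : x \in porbit s (rep (porbit s x)).
    by rewrite repP porbit_id.
  by exists i.
pose f x := (t ^+ e x) (rep (phi (porbit s x))).
have forb x : porbit t (f x) = phi (porbit s x).
  by rewrite /f porbit_perm; have /imsetP[z _ ->] := phiP _ (orb x); rewrite repP.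
have lens x : #|porbit s (rep (porbit s x))| = #|porbit t (rep (phi (porbit s x)))|.
  by rewrite -(porbit_perm t (e x)) -/(f x) forb repP phi_card.
have f_inj : injective f.
  move=> x x' exx; have : phi (porbit s x) = phi (porbit s x') by rewrite -!forb exx.
  move/(phi_inj _ _ (orb x) (orb x')) => eB.
  rewrite -(he x) -(he x') -eB; apply/eqP; rewrite porbit_expE lens -porbit_expE.
  by apply/eqP; move: exx; rewrite /f eB.
have fs x : f (s x) = t (f x).
  have eB : porbit s (s x) = porbit s x by have := porbit_perm s 1 x; rewrite expg1.
  rewrite /f eB -permM -expgSr; apply/eqP; rewrite porbit_expE -lens -porbit_expE.
  by rewrite -{1}eB he expgSr permM he.
exists (perm f_inj); apply: (mulgI (perm f_inj)); rewrite -conjgC.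
by apply/permP => x; rewrite !permM !permE fs.
Qed.

End CycleType.

Lemma porbits_partition (T : finType) (s : {perm T}) :
  finset.partition (porbits s) [set: T]%SET.
Proof.
apply/and3P; split.
- apply/eqP/setP => x; rewrite inE; apply/bigcupP.
  by exists (porbit s x); rewrite ?porbit_id ?imset_f.
- apply/finset.trivIsetP => _ _ /imsetP[x _ ->] /imsetP[y _ ->].
  rewrite -finset.setI_eq0; apply: contraR => /finset.set0Pn[z].
  by rewrite inE -!eq_porbit_mem => /andP[/eqP <- ->].
- apply/imsetP => -[x _ e]; have := porbit_id s x.
  by rewrite -e inE.
Qed.

Section YoungOfSeq.
Local Open Scope nat_scope.

Lemma young_of_seq n d (sh : seq nat) :
  sorted geq sh -> size sh = d -> sumn sh = n -> exists lam : young n d, parts lam = sh.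
Proof.
move=> so sz su.
have le i : i \in sh -> i <= n.
  rewrite -su; elim: (sh) => //= a u IH; rewrite inE => /predU1P[->|/IH]; lia.
have szt : size [seq (inord i : 'I_n.+1) | i <- sh] == d by rewrite size_map sz.
have vE : [seq val i | i <- Tuple szt] = sh.
  rewrite -map_comp -[RHS]map_id; apply/eq_in_map => i /le lei /=.
  by rewrite inordK.
have yt : is_young (Tuple szt) by rewrite /is_young vE so su eqxx.
by exists (exist _ (Tuple szt) yt).
Qed.

Variable n : nat.

(** Cycles have positive length, so there are at most n of them and zeros fill the list up to n
    parts. *)
Lemma cycle_type_young (s : 'S_n) : exists lam : young n n,
  perm_eq (parts lam) (cycle_type s ++ nseq (n - size (cycle_type s)) 0).
Proof.
set L := _ ++ _.
have pos c : c \in cycle_type s -> 0 < c.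
  case/mapP => B; rewrite mem_enum => /imsetP[x _ ->] ->.
  by rewrite lt0n card_porbit_neq0.
have sum_ct : sumn (cycle_type s) = n.
  rewrite /cycle_type sumnE big_map big_enum /=.
  rewrite -[RHS]card_ord -cardsT; apply/esym/card_partition.
  exact: (porbits_partition s).
have le : size (cycle_type s) <= n.
  rewrite -[X in _ <= X]sum_ct; elim: (cycle_type s) pos => //= a u IH hp.
  have := hp a (mem_head _ _); have := IH (fun c hc => hp c (mem_behead (s := a :: u) hc)).
  lia.
have [|||lam hl] := @young_of_seq n n (sort geq L).
- by apply: sort_sorted => a b; rewrite /geq /= leq_total.
- by rewrite size_sort size_cat size_nseq subnKC.
- by rewrite (perm_sumn (permEl (perm_sort _ _))) sumn_cat sumn_nseq mul0n addn0.
by exists lam; rewrite hl perm_sort.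
Qed.

Lemma card_classes_perm : #|classes [set: 'S_n]%G| <= #|{: young n n}|.
Proof.
have /choice[ct hct] := cycle_type_young.
have ct_conj s t : ct s = ct t -> exists g : 'S_n, t = (s ^ g)%g.
  move=> e; apply: cycle_type_conj.
  (* Discarding the zeros recovers the cycle types from the padded lists. *)
  have := perm_filter (fun c => 0 < c) (perm_trans (etrans (perm_sym _ _) (hct s)) (etrans (congr1 (fun l => perm_eq (parts l) _) e) (hct t))).
  have pos u : [seq c <- cycle_type u ++ nseq (n - size (cycle_type u)) 0 | 0 < c] = cycle_type u.
    rewrite filter_cat [X in _ ++ X](_ : _ = [::]) ?cats0; last first.
      by elim: (n - _).
    apply/all_filterP/allP => c /mapP[B]; rewrite mem_enum => /imsetP[x _ ->] ->.
    by rewrite lt0n card_porbit_neq0.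
  by rewrite !pos.
rewrite -(@card_in_imset _ _ (fun K : {set 'S_n} => ct (repr K))) ?max_card //.
move=> K L hK hL /ct_conj[g e].
have [_ eK] := repr_classesP hK; have [_ eL] := repr_classesP hL.
by rewrite eK eL e classGidl ?inE.
Qed.

End YoungOfSeq.

(** * Exhaustion of the irreducible representations *)

Section AllIrreducibles.
Local Open Scope ring_scope.
Local Open Scope complex_scope.
Variables (R : realType) (n : nat).
Local Notation F := R[i].
Local Notation G := [set: 'S_n]%G.

Definition sym_irr : irrType F G := DecSocleType (regular_repr F G).

(** Shapes inject into the irreducible components, whose number is that of the conjugacy classes and
    hence at most that of the shapes; the injection is onto. *)
Lemma irr_rsim_specht m (rG : mx_representation F G m) : mx_irreducible rG ->
  exists lam : young n n, mx_rsim rG (specht_repr lam).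
Proof.
move=> irrG; have charG := pchar_complex_group R n.
pose f (lam : young n n) := irr_comp sym_irr (specht_repr (R := R) lam).
have fsim m' (r : mx_representation F G m') (lam : young n n) :
    mx_irreducible r -> irr_comp sym_irr r = f lam -> mx_rsim r (specht_repr lam).
  move=> irr e; apply: mx_rsim_trans (rsim_irr_comp_pchar sym_irr charG irr) _.
  rewrite e; apply: mx_rsim_sym.
  exact: rsim_irr_comp_pchar (specht_irr R lam).
have f_inj : injective f.
  move=> lam mu e; apply: (@specht_rsim_inj R n n).
  exact: fsim (specht_irr R lam) e.
have /codomP[lam e] : irr_comp sym_irr rG \in codom f.
  apply: inj_card_onto => //.
  by rewrite card_irr_pchar ?card_classes_perm //; exact: group_closure_closed_field.
by exists lam; apply: fsim.
Qed.

Lemma reshape_index_cat (s t : seq nat) k : (k < sumn s)%N ->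
  reshape_index (s ++ t) k = reshape_index s k.
Proof.
move=> ltk; have lr := reshape_indexP ltk; have lc := reshape_offsetP ltk.
rewrite -{1}(reshape_indexK s k).
have -> : flatten_index s (reshape_index s k) (reshape_offset s k) =
          flatten_index (s ++ t) (reshape_index s k) (reshape_offset s k).
  by rewrite /flatten_index take_cat lr.
by rewrite flatten_indexKl // nth_cat lr.
Qed.

Lemma reshape_offset_cat (s t : seq nat) k : (k < sumn s)%N ->
  reshape_offset (s ++ t) k = reshape_offset s k.
Proof.
move=> ltk; rewrite /reshape_offset reshape_index_cat // take_cat.
by rewrite reshape_indexP.
Qed.

(** All boxes lie in the common prefix [z], whose parts already sum to n, so both shapes give
    literally the same symmetrizer. *)
Lemma specht_rsim_cat d1 d2 (lam : young n d1) (mu : young n d2) z t1 t2 :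
  parts lam = z ++ t1 -> parts mu = z ++ t2 -> sumn z = n ->
  mx_rsim (specht_repr (R := R) lam) (specht_repr mu).
Proof.
move=> e1 e2 sz.
have er : row_stab lam = row_stab mu.
  apply/setP => s; rewrite !inE; apply: eq_forallb => k.
  by rewrite e1 e2 !reshape_index_cat ?sz.
have ec : col_stab lam = col_stab mu.
  apply/setP => s; rewrite !inE; apply: eq_forallb => k.
  by rewrite e1 e2 !reshape_offset_cat ?sz.
have ey : young_symmetrizer (R := R) lam = young_symmetrizer mu.
  by rewrite /young_symmetrizer er ec.
by rewrite /specht_repr ey; exact: mx_rsim_refl.
Qed.

Variable d : nat.
Local Notation V := (perm_factors_representation n d).

Lemma row_perm_factors i (s : 'S_n) :
  (forall k, word i (s^-1%g k) = word (d := d) i k) ->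
  row i (perm_factors (R := R) d s) = delta_mx 0 i.
Proof.
move=> h; apply/rowP => j; rewrite !mxE eqxx /=; congr (_%:R).
have -> : [ffun k => word i (s^-1%g k)] = word i by apply/ffunP => k; rewrite ffunE h.
by rewrite (inj_eq enum_val_inj).
Qed.

(* A column with more than [d] boxes has two boxes carrying the same letter. *)
Lemma young_op_tensor0 d' (lam : young n d') : (0 < nth 0 (parts lam) d)%N ->
  young_op lam (V : mx_representation F G _) = 0.
Proof.
move=> gt0; suff z : col_op lam (V : mx_representation F G _) = 0.
  by rewrite /young_op z mulmx0.
have [k0 hk0] : exists k, box_row lam k = d.
  have : (0 < #|[set k | box_row lam k == d]%SET|)%N by rewrite card_box_row.
  by case/card_gt0P => k; rewrite inE => /eqP; exists k.
have kk0 : exists k, box_row lam k = d /\ box_col lam k = 0%N.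
  have ltn : (flatten_index (parts lam) d 0 < n)%N.
    by rewrite -[X in (_ < X)%N](sumn_parts lam) flatten_indexP.
  exists (Ordinal ltn); split.
    by rewrite /box_row /= flatten_indexKl.
  by rewrite /box_col /= flatten_indexKr.
case: kk0 => k1 [r1 c1].
have /choice[b hb] : forall a : 'I_d.+1, exists k, box_row lam k = a /\ box_col lam k = 0%N.
  move=> a; have [|j] := @box_above _ _ lam k1 a; first by rewrite r1 -ltnS.
  by rewrite c1 => ? ?; exists j.
apply/row_matrixP => i; rewrite row0.
have [a [a' [ne e]]] : exists a a', a != a' /\ word (d := d) i (b a) = word i (b a').
  apply: contrapT => no; have : injective (fun a => word (d := d) i (b a)).
    by move=> a a' e; apply/eqP/negPn/negP => ne; apply: no; exists a, a'.
  by move=> /leq_card; rewrite !card_ord ltnn.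
have bne : b a != b a'.
  apply: contraNneq ne => eb; apply/eqP/val_inj => /=.
  by rewrite -(hb a).1 -(hb a').1 eb.
have tc : tperm (b a) (b a') \in col_stab lam.
  by apply/mem_col_stab => k; case: tpermP => // ->; rewrite (hb a).2 (hb a').2.
have := col_opMl (V : mx_representation F G _) tc.
move=> /(congr1 (row i)); rewrite row_mul row_perm_factors.
  rewrite -rowE odd_tperm bne expr1 scaleN1r => h.
  apply/rowP => j; move/rowP/(_ j): h; rewrite !mxE => h.
  have /eqP : (col_op lam (V : mx_representation F G _)) i j *+ 2 = 0.
    by rewrite mulr2n {1}h addNr.
  by rewrite -mulr_natr mulf_eq0 pnatr_eq0 orbF => /eqP.
by move=> k; rewrite tpermV; case: tpermP => // ->.
Qed.

End AllIrreducibles.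

Section TensorSimple.
Local Open Scope ring_scope.
Local Open Scope complex_scope.
Variables (R : realType) (n d : nat).
Local Notation F := R[i].
Local Notation G := [set: 'S_n]%G.
Local Notation V := (perm_factors_representation n d : mx_representation F G _).

(** The shape obtained first has n parts. Since [young_op_tensor0] excludes shapes with more than d
    rows, it can be padded with zeros or truncated to exactly d parts. *)
Lemma tensor_simple_specht (W : 'M[F]_(tdim n d)) (modW : mxmodule V W) :
  mxsimple V W -> exists lam : young n d, mx_rsim (submod_repr modW) (specht_repr lam).
Proof.
move=> simW.
have [|lam sim] := @irr_rsim_specht R n _ (submod_repr modW); first by apply/submod_mx_irr.
have z : nth 0%N (parts lam) d = 0%N.
  apply/eqP; rewrite -leqn0 leqNgt; apply/negP => /(young_op_tensor0 R) z.
  have /eqP[] := young_op_specht_neq0 R lam; apply: (rsim_young_op sim).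
  apply: (@val_submod_inj _ _ W).
  by rewrite -[young_op _ _ as X in val_submod X]mul1mx val_submod_young_op z mulmx0 linear0.
have [lt|ge] := leqP (size (parts lam)) d.
  pose L := parts lam ++ nseq (d - size (parts lam)) 0%N.
  have [|||mu hmu] := @young_of_seq n d L.
  - have zeros x k : path geq x (nseq k 0%N) by elim: k x => //= k IH x; exact: IH.
    by have := sorted_parts lam; rewrite /L; case: (parts lam) => [|a s] /=;
      [case: (d - 0)%N => //= k; exact: zeros|rewrite cat_path zeros andbT].
  - by rewrite size_cat size_nseq subnKC.
  - by rewrite sumn_cat sumn_nseq mul0n addn0 sumn_parts.
  exists mu; apply: mx_rsim_trans sim _.
  by apply: (@specht_rsim_cat _ _ _ _ lam mu (parts lam) [::] _ _ hmu); rewrite ?cats0 ?sumn_parts.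
have tl : drop d (parts lam) = nseq (size (parts lam) - d) 0%N.
  apply: (@eq_from_nth _ 0%N); first by rewrite size_drop size_nseq.
  move=> i _; rewrite nth_drop nth_nseq if_same; apply/eqP; rewrite -leqn0.
  have := @nth_parts_anti _ _ lam d (d + i) (leq_addr _ _).
  by rewrite z.
have su : sumn (take d (parts lam)) = n.
  by rewrite -[RHS](sumn_parts lam) -[in RHS](cat_take_drop d (parts lam)) tl sumn_cat sumn_nseq mul0n addn0.
have [|||mu hmu] := @young_of_seq n d (take d (parts lam)).
- by apply: take_sorted; exact: sorted_parts.
- by rewrite size_takel // ltnW.
- exact: su.
exists mu; apply: mx_rsim_trans sim _.
by apply: (@specht_rsim_cat _ _ _ _ lam mu (take d (parts lam)) (drop d (parts lam)) [::]);
  rewrite ?cat_take_drop ?cats0.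
Qed.

End TensorSimple.

(** * Isotypic blocks of the tensor space *)

Section CentScalar.
Local Open Scope ring_scope.

(** Schur's lemma for an operator on the ambient space: the restriction of [Y] to [U], written in a
    basis [b] of [U], centralizes an irreducible representation over a splitting field. *)
Lemma mxsimple_cent_scalar (F : fieldType) (gT : finGroupType) (G : {group gT}) m
    (rG : mx_representation F G m) (U Y : 'M[F]_m) :
  group_splitting_field F G -> mxsimple rG U ->
  (forall x, Y *m rG x = rG x *m Y)%R -> (U *m Y <= U)%MS ->
  exists c : F, (U *m Y = c *: U)%R.
Proof.
move=> splitF simU cY UY; have [modU _ _] := simU.
have [b [bU Ub valE]] : exists b : 'M[F]_(\rank U, m), [/\ (U <= b)%MS, (b <= U)%MS &
    forall X : 'M[F]_(\rank U), val_submod X = X *m b].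
  by exists (val_submod 1%:M); rewrite val_submod1 val_submodP; split=> // X; rewrite val_submodE.
have vY : (b *m Y <= U)%MS by apply: submx_trans (submxMr _ Ub) UY.
pose Z := in_submod U (b *m Y).
have ZE : (Z *m b = b *m Y)%R by rewrite -valE in_submodK.
have bx x : x \in G -> (submod_repr modU x *m b = b *m rG x)%R.
  by move=> Gx; rewrite -valE -[submod_repr modU x]mul1mx val_submodJ // valE mul1mx.
have cZ : centgmx (submod_repr modU) Z.
  apply/centgmxP => x Gx; apply: (@val_submod_inj _ _ U); rewrite !valE.
  move: (submod_repr modU x) (bx x Gx) => r hr; move: (Z) ZE => z hz.
  by rewrite -!mulmxA hr hz [RHS]mulmxA hr mulmxA hz -!mulmxA cY.
have irrU : mx_irreducible (submod_repr modU) by apply/submod_mx_irr.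
have /is_scalar_mxP[c eZ] := mx_abs_irr_cent_scalar (splitF _ _ irrU) cZ.
exists c; have /submxP[D ->] := bU.
by rewrite -mulmxA -ZE eZ mul_scalar_mx scalemxAr.
Qed.

End CentScalar.

Section Adjoint.
Local Open Scope ring_scope.
Local Open Scope sesquilinear_scope.
Variable F : numClosedFieldType.

Lemma adjM m p q (A : 'M[F]_(m, p)) (B : 'M[F]_(p, q)) : (A *m B)^t* = B^t* *m A^t*.
Proof. by rewrite trmx_mul map_mxM. Qed.

End Adjoint.

Section Blocks.
Local Open Scope ring_scope.
Local Open Scope complex_scope.
Local Open Scope sesquilinear_scope.
Variables (R : realType) (n d : nat).
Local Notation F := R[i].
Local Notation G := [set: 'S_n]%G.
Local Notation V := (perm_factors_representation n d : mx_representation F G _).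
Local Notation N := (tdim n d).
Let charG := pchar_complex_group R n.

Fact block_op_key : unit. Proof. by []. Qed.
(** The primitive central idempotent of the group algebra attached to V_lam, evaluated on tensors as
    an operator on row vectors. *)
Definition block_op (lam : young n d) : 'M[F]_N := locked_with block_op_key
  (gring_op V (Wedderburn_id (irr_comp (sym_irr R n) (specht_repr lam)))).

Lemma block_opE lam : block_op lam =
  gring_op V (Wedderburn_id (irr_comp (sym_irr R n) (specht_repr lam))).
Proof. by rewrite /block_op locked_withE. Qed.

Lemma gring_opE_sum m (rG : mx_representation F G m) A :
  gring_op rG A = \sum_(k < #|G|) (gring_row A) 0 k *: rG (enum_val k).
Proof.
rewrite gring_opE /gring_mx /= mulmx_sum_row linear_sum /=; apply: eq_bigr => k _.
by rewrite linearZ /= rowK mxvecK.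
Qed.

Lemma val_submod_gring_op m (rG : mx_representation F G m) (U : 'M[F]_m)
    (modU : mxmodule rG U) A k (X : 'M[F]_(k, \rank U)) :
  val_submod (X *m gring_op (submod_repr modU) A) = val_submod X *m gring_op rG A.
Proof.
rewrite !gring_opE_sum !mulmx_sumr linear_sum /=; apply: eq_bigr => x _.
by rewrite -!scalemxAr linearZ /= -(val_submodJ modU) ?inE.
Qed.

(** The central idempotents sum to 1, and those of the other components act as 0 on [rG]. *)
Lemma irr_comp_op m (rG : mx_representation F G m) (j : sym_irr R n) :
  mx_irreducible rG ->
  gring_op rG (Wedderburn_id j) = (j == irr_comp (sym_irr R n) rG)%:R%:M.
Proof.
move=> irrG; have [->|ne] := eqVneq; last first.
  by rewrite (irr_comp'_op0_pchar charG irrG ne (Wedderburn_id_mem j)) raddf0.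
rewrite -(gring_op1 rG) -(Wedderburn_sum_id_pchar (sym_irr R n) charG).
rewrite linear_sum (bigD1 (irr_comp (sym_irr R n) rG)) //= big1 ?addr0 // => i ne.
exact: (irr_comp'_op0_pchar charG irrG ne (Wedderburn_id_mem i)).
Qed.

Lemma irr_comp_specht_inj (lam mu : young n d) :
  irr_comp (sym_irr R n) (specht_repr lam) = irr_comp (sym_irr R n) (specht_repr mu) ->
  lam = mu.
Proof.
move=> e; apply: (@specht_rsim_inj R n d).
apply: mx_rsim_trans (rsim_irr_comp_pchar (sym_irr R n) charG (specht_irr R lam)) _.
rewrite e; apply: mx_rsim_sym.
exact: rsim_irr_comp_pchar (specht_irr R mu).
Qed.

Lemma block_op_simple (lam mu : young n d) (W : 'M[F]_N) (modW : mxmodule V W) :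
  mx_rsim (submod_repr modW) (specht_repr mu) ->
  W *m block_op lam = (lam == mu)%:R *: W.
Proof.
move=> sim.
have irrW : mx_irreducible (submod_repr modW).
  by apply: mx_rsim_irr (mx_rsim_sym sim) _; exact: specht_irr.
have /submxP[D ->] : (W <= val_submod (1%:M : 'M[F]_(\rank W)))%MS.
  by rewrite val_submod1.
rewrite -mulmxA block_opE -(val_submod_gring_op modW) irr_comp_op // (irr_comp_rsim_pchar _ charG sim).
rewrite (inj_eq irr_comp_specht_inj) mul1mx; case: (lam == mu); first by rewrite scale1r.
by rewrite raddf0 linear0 mulmx0 scale0r.
Qed.

Lemma tensor_decomposition : exists (I : finType) (W : I -> 'M[F]_N) (ty : I -> young n d),
  [/\ forall i, mxsimple V (W i), (\sum_i W i :=: 1%:M)%MS &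
      forall i (modW : mxmodule V (W i)), mx_rsim (submod_repr modW) (specht_repr (ty i))].
Proof.
have [I W /= simW defW _] := dec_mx_reducible_semisimple (mxmodule1 V) (mx_Maschke_pchar V charG).
have /choice[ty hty] : forall i, exists lam : young n d,
    forall modW : mxmodule V (W i), mx_rsim (submod_repr modW) (specht_repr lam).
  move=> i; have [modW _ _] := simW i.
  have [lam sim] := tensor_simple_specht modW (simW i).
  exists lam => modW'; apply: mx_rsim_trans sim.
  by apply/mx_rsim_iso; apply: mx_iso_refl.
by exists I, W, ty.
Qed.

Lemma eq_on_decomposition (I : finType) (W : I -> 'M[F]_N) m (A B : 'M[F]_(N, m)) :
  (\sum_i W i :=: 1%:M)%MS -> (forall i, W i *m A = W i *m B) -> A = B.
Proof.
move=> defW h; have /sub_sumsmxP[u e] : (1%:M <= \sum_i W i)%MS by rewrite defW.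
rewrite -[A]mul1mx -[B]mul1mx e !mulmx_suml; apply: eq_bigr => i _.
by rewrite -!mulmxA h.
Qed.

Lemma block_decomposition : exists (I : finType) (W : I -> 'M[F]_N) (ty : I -> young n d),
  [/\ forall i, mxsimple V (W i), (\sum_i W i :=: 1%:M)%MS,
      forall i (modW : mxmodule V (W i)), mx_rsim (submod_repr modW) (specht_repr (ty i)) &
      forall lam i, W i *m block_op lam = (lam == ty i)%:R *: W i].
Proof.
have [I [W [ty [simW defW hty]]]] := tensor_decomposition.
exists I, W, ty; split=> // lam i; have [modW _ _] := simW i.
exact: block_op_simple (hty i modW).
Qed.

Lemma block_op_sum : \sum_lam block_op lam = 1%:M.
Proof.
have [I [W [ty [simW defW hty bW]]]] := block_decomposition.
apply: (eq_on_decomposition defW) => i; have [modW _ _] := simW i.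
rewrite mulmx_sumr [RHS]mulmx1.
under eq_bigr => lam _ do rewrite bW.
rewrite -scaler_suml (bigD1 (ty i)) //= eqxx big1 ?addr0 ?scale1r //.
by move=> lam /negPf ->.
Qed.

Lemma block_op_idem lam : block_op lam *m block_op lam = block_op lam.
Proof.
have [I [W [ty [simW defW hty bW]]]] := block_decomposition.
apply: (eq_on_decomposition defW) => i; have [modW _ _] := simW i.
rewrite mulmxA.
rewrite bW.
rewrite -scalemxAl.
by rewrite bW scalerA; case: eqP; rewrite ?mul1r ?mul0r.
Qed.

Lemma block_op_cent lam (s : 'S_n) : block_op lam *m V s = V s *m block_op lam.
Proof.
have [I [W [ty [simW defW hty bW]]]] := block_decomposition.
apply: (eq_on_decomposition defW) => i; have [modW _ _] := simW i.
rewrite !mulmxA bW.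
have /submxP[D e] := mxmoduleP modW s (finset.in_setT s).
by rewrite e -mulmxA bW -scalemxAl e -scalemxAr.
Qed.

Lemma cent_block_op lam (T : 'M[F]_N) : (forall s, T *m V s = V s *m T) ->
  T *m block_op lam = block_op lam *m T.
Proof.
move=> cT; rewrite block_opE gring_opE_sum mulmx_sumr mulmx_suml; apply: eq_bigr => k _.
by rewrite -scalemxAr -scalemxAl cT.
Qed.

Lemma perm_factors_tr (s : 'S_n) : (V s)^T = V s^-1%g.
Proof.
apply/matrixP => i j; rewrite !mxE invgK; congr (nat_of_bool _)%:R.
by apply/eqP/eqP => e; apply/ffunP => k; rewrite ?e ffunE ?e ?ffunE ?permK ?permKV.
Qed.

Lemma perm_factors_adj (s : 'S_n) : (V s)^t* = V s^-1%g.
Proof. by rewrite perm_factors_tr; apply/matrixP => i j; rewrite !mxE conjC_nat. Qed.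

(** The adjoint of [V s] is [V s^-1], so the adjoint of the idempotent commutes with every [V s],
    hence with the idempotent itself, a combination of them. *)
Lemma block_op_herm lam : (block_op lam)^t* = block_op lam.
Proof.
set e := block_op lam; set f := e^t*.
have ee : e *m e = e by exact: block_op_idem.
have adjK (A : 'M[F]_N) : (A^t*)^t* = A by exact: trmxCK.
have ff : f *m f = f by rewrite /f -adjM ee.
have fe : f *m e = e *m f.
  apply: cent_block_op => s.
  by rewrite -[V s]adjK perm_factors_adj /f -!adjM -block_op_cent.
(* A normal idempotent is self-adjoint. *)
suff z : e - f *m e = 0.
  have {}z : e = f *m e by apply/eqP; rewrite -subr_eq0 z.
  have h : (f *m e)^t* = f *m e by rewrite adjM /f adjK.
  by rewrite -z in h.
have : (e - f *m e)^t* *m (e - f *m e) = 0.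
  have -> : (e - f *m e)^t* = f - f *m e.
    by rewrite raddfB /= map_mxB -/(e^t*) -/f adjM adjK fe.
  rewrite mulmxBl !mulmxBr mulmxA ff -[f *m e *m e]mulmxA ee.
  by rewrite [f *m e *m (f *m e)]mulmxA -[f *m e *m f]mulmxA -fe mulmxA ff -mulmxA ee !subrr.
move: (e - f *m e) => M M0; apply/matrixP => i j; rewrite mxE.
have /eqP := congr1 (fun A : 'M[F]_N => A j j) M0; rewrite !mxE.
rewrite psumr_eq0 => [|k _]; last by rewrite !mxE mulrC mul_conjC_ge0.
by move=> /allP/(_ i (mem_index_enum _)); rewrite !mxE mulrC mul_conjC_eq0 => /eqP.
Qed.

(** The idempotent fixes every copy of V_lam. Conversely, in a decomposition into simple summands it
    kills those of another type, so a fixed vector lies in the sum of those of type [lam]. *)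
Lemma schur_weyl_blockE lam (v : 'rV[F]_N) :
  schur_weyl_block lam v <-> v *m block_op lam = v.
Proof.
split=> [[Ws hWs sv]|hv].
  suff : (v <= kermx (block_op lam - 1%:M))%MS.
    by move/sub_kermxP; rewrite mulmxBr mulmx1 => /eqP; rewrite subr_eq0 => /eqP.
  apply: submx_trans sv _; elim: Ws hWs => [|W Ws IH] hWs; first by rewrite big_nil sub0mx.
  rewrite big_cons addsmx_sub IH ?andbT; last first.
    by move=> W' hW'; apply: hWs; rewrite inE hW' orbT.
  have [modW sim] := hWs W (mem_head _ _).
  by apply/sub_kermxP; rewrite mulmxBr mulmx1 (block_op_simple _ sim) eqxx scale1r subrr.
have [I [W [ty [simW defW hty bW]]]] := block_decomposition.
exists [seq W i | i <- enum I & ty i == lam].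
  move=> U hU; have [i hi ->] := elimT (@mapP _ _ W [seq i <- enum I | ty i == lam] U) hU.
  move: hi; rewrite mem_filter => /andP[/eqP tyi _].
  by have [modW _ _] := simW i; exists modW; rewrite -tyi.
rewrite big_map big_filter big_enum_cond /=.
have /sub_sumsmxP[u e] : (v <= \sum_i W i)%MS by rewrite defW submx1.
rewrite -hv e mulmx_suml (bigID (fun i => ty i == lam)) /= [X in _ + X]big1 ?addr0; last first.
  move=> i ne; have [modW _ _] := simW i.
  by rewrite -mulmxA bW eq_sym (negPf ne) scale0r mulmx0.
apply: summx_sub => i tyi; have [modW _ _] := simW i.
rewrite -mulmxA bW eq_sym tyi scale1r.
by apply: submx_trans (submxMl _ _) _; exact: (sumsmx_sup i).
Qed.

(** An orthogonal projection is determined by its fixed vectors: if P and Q have the same ones, then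
    P Q = Q and Q P = P, and the adjoint of the second identity gives P Q = P. *)
Lemma block_projectionE lam : block_projection R lam = (block_op lam)^T.
Proof.
have adjT : ((block_op lam)^T)^t* = (block_op lam)^T.
  by rewrite -[in RHS]block_op_herm; apply/matrixP => i j; rewrite !mxE.
have P1 : is_orthogonal_projection (schur_weyl_block (R := R) lam) (block_op lam)^T.
  split=> //; first by rewrite -trmx_mul block_op_idem.
  move=> v; rewrite schur_weyl_blockE -trmx_mul; split=> [->//|/trmx_inj//].
rewrite /block_projection; case: xgetP => [P _ [P2h P2i P2f]|/(_ _ P1)//].
have [P1h P1i P1f] := P1.
have mulP (A B : 'M[F]_N) : B *m B = B ->
    (forall v : 'rV_N, B *m v^T = v^T -> A *m v^T = v^T) -> A *m B = B.
  move=> BB h; apply/matrixP => i j.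
  have := h (col j B)^T; rewrite trmxK colE mulmxA BB -colE => /(_ erefl).
  by rewrite colE mulmxA -!colE => /colP/(_ i); rewrite !mxE.
have e1 : P *m (block_op lam)^T = (block_op lam)^T.
  by apply: mulP => // v; rewrite -P1f P2f.
have e2 : (block_op lam)^T *m P = P.
  by apply: mulP => // v; rewrite -P2f P1f.
have := congr1 (fun A : 'M[F]_N => A^t*) e2; rewrite trmx_mul map_mxM P2h adjT e1.
by move=> ->.
Qed.

(** Commuting with the equivariant projection [P] onto a summand of type [lam], [Y] preserves this
    summand and is a scalar c there. An isomorphism onto another summand of this type, precomposed
    with [P], lies in the commutant of S_n, so it carries the same c over. For an empty block c = 0
    serves. *)
Lemma cent_scalar_block lam (Y : 'M[F]_N) :
  (forall s, Y *m V s = V s *m Y) ->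
  (forall T : 'M[F]_N, (forall s, T *m V s = V s *m T) -> Y *m T = T *m Y) ->
  exists c : F, block_op lam *m Y = c *: block_op lam.
Proof.
move=> cY cYT.
have [I [W [ty [simW defW hty bW]]]] := block_decomposition.
have [i0 ty0|no] := pickP (fun i => ty i == lam); last first.
  exists 0; rewrite scale0r; suff -> : block_op lam = 0 by rewrite mul0mx.
  apply: (eq_on_decomposition defW) => i; have [modW _ _] := simW i.
  by rewrite bW eq_sym no scale0r mulmx0.
have [modW0 _ _] := simW i0; have hty0 := hty i0 modW0.
have [P [PW WP cP]] := maschke_projection modW0.
have WY : (W i0 *m Y <= W i0)%MS.
  by rewrite -{1}WP -mulmxA -cYT // mulmxA; apply: submx_trans (submxMl _ _) PW.
have [c hc] : exists c : F, W i0 *m Y = c *: W i0.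
  by apply: (mxsimple_cent_scalar _ (simW i0)) => //; exact: group_closure_closed_field.
exists c; apply: (eq_on_decomposition defW) => i; have [modW _ _] := simW i.
rewrite -scalemxAr mulmxA bW -scalemxAl.
case: eqP => [tyi|_]; last by rewrite !scale0r scaler0.
rewrite !scale1r.
have [f uf homf defWi] : mx_iso V (W i0) (W i).
  apply/(mx_rsim_iso modW0 modW); apply: mx_rsim_trans hty0 _.
  by rewrite (eqP ty0) tyi; apply: mx_rsim_sym.
have cPf s : P *m f *m V s = V s *m (P *m f).
  have /submxP[D eP] := PW; have := hom_mxP homf s (finset.in_setT s) => h.
  by rewrite mulmxA -cP eP -!mulmxA; congr (D *m _); rewrite !mulmxA h.
have /submxP[D ->] : (W i <= W i0 *m f)%MS by rewrite defWi.
rewrite -mulmxA; have -> : W i0 *m f = W i0 *m (P *m f) by rewrite mulmxA WP.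
by rewrite -(mulmxA (W i0)) -cYT // (mulmxA (W i0)) hc -scalemxAl -scalemxAr.
Qed.

End Blocks.

(** * Tensor powers and the commutant of the symmetric group *)

Section Polarization.
Local Open Scope ring_scope.
Variables (C : comPzRingType) (n : nat).

(** Inclusion-exclusion over the sets containing the image of [f]. An injective [f] is onto and
    leaves only the full set. *)
Lemma sum_supersets_sign (f : {ffun 'I_n -> 'I_n}) :
  \sum_(S : {set 'I_n}) (-1) ^+ (n - #|S|) * (\prod_k (f k \in S)%:R) =
  (injectiveb f)%:R :> C.
Proof.
have prodE (S : {set 'I_n}) : \prod_k (f k \in S)%:R = [forall k, f k \in S]%:R :> C.
  have [/forallP h|/forallPn[k /negPf nk]] := boolP [forall k, f k \in S].
    by rewrite big1 // => k _; rewrite h.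
  by rewrite (bigD1 k) //= nk mul0r.
have [/injectiveP f_inj|ninj] := boolP (injectiveb f).
  rewrite (bigD1 [set: 'I_n]%SET) //= cardsT card_ord subnn expr0 mul1r big1 => [|k _]; last by rewrite inE.
  rewrite big1 ?addr0 // => S nS; rewrite prodE.
  case: forallP => [h|]; last by rewrite mulr0.
  case/eqP: nS; apply/setP => i; rewrite inE.
  by have := injF_onto f_inj i => /codomP[k ->]; rewrite h.
have [i0 hi0] : exists i0, forall k, f k != i0.
  apply: contrapT => no; case/negP: ninj; apply/injectiveP.
  have sub : [set: 'I_n]%SET \subset (f @: [set: 'I_n])%SET.
    apply/fintype.subsetP => i _; apply: contrapT => ni; apply: no; exists i => k.
    by apply: contra_notN ni => /eqP <-; apply: imset_f; rewrite inE.
  have /finset.imset_injP inj : #|(f @: [set: 'I_n])%SET| == #|[set: 'I_n]%SET|.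
    by rewrite eqn_leq leq_imset_card subset_leq_card.
  by move=> a b; apply: inj; rewrite inE.
rewrite (bigID (fun S : {set 'I_n} => i0 \in S)) /=.
(* With [i0] outside the image, inserting [i0] pairs the remaining sets with opposite signs. *)
rewrite (reindex_onto (fun S : {set 'I_n} => i0 |: S)%SET (fun S => S :\ i0)%SET) /=; last first.
  by move=> S hS; rewrite finset.setD1K.
rewrite (eq_bigl (fun S : {set 'I_n} => i0 \notin S)); last first.
  move=> S; rewrite setU11 /=; apply/eqP/idP => [<-|h]; first by rewrite !inE eqxx.
  by rewrite setU1K.
rewrite -big_split big1 //= => S hS; rewrite !prodE.
have -> : [forall k, f k \in (i0 |: S)%SET] = [forall k, f k \in S].
  by apply: eq_forallb => k; rewrite !inE (negPf (hi0 k)).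
rewrite cardsU1 hS add1n -mulrDl.
have ltS : (#|S| < n)%N.
  rewrite -[X in (_ < X)%N]card_ord -cardsT; apply: proper_card.
  by apply/properP; split; [exact: finset.subsetT|exists i0; rewrite ?inE].
by rewrite -(subnSK ltS) exprS mulN1r addrN mul0r.
Qed.

(** Ryser's formula for the permanent of [b]: expanding the product over all maps, the signed sum
    keeps the injective ones. *)
Lemma polarization (b : 'I_n -> 'I_n -> C) :
  \sum_(s : 'S_n) \prod_k b (s k) k =
  \sum_(S : {set 'I_n}) (-1) ^+ (n - #|S|) * \prod_k (\sum_(i in S) b i k).
Proof.
have -> : \sum_(S : {set 'I_n}) (-1) ^+ (n - #|S|) * \prod_k (\sum_(i in S) b i k) =
  \sum_(f : {ffun 'I_n -> 'I_n}) (injectiveb f)%:R * \prod_k b (f k) k.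
  under [RHS]eq_bigr do rewrite -sum_supersets_sign mulr_suml.
  rewrite exchange_big /=; apply: eq_bigr => S _.
  under [X in _ * X]eq_bigr => k _ do rewrite big_mkcond /=.
  rewrite bigA_distr_bigA /= mulr_sumr; apply: eq_bigr => f _.
  rewrite -mulrA -big_split /=; congr (_ * _); apply: eq_bigr => k _.
  by case: (f k \in S); rewrite ?mul1r ?mul0r.
rewrite (bigID (fun f : {ffun 'I_n -> 'I_n} => injectiveb f)) /= [X in _ + X]big1 ?addr0; last first.
  by move=> f /negPf ->; rewrite mul0r.
rewrite [RHS](reindex (fun s : 'S_n => pval s)); last first.
  have s0 : 'S_n := 1%g.
  by exists (insubd s0) => /= f Uf; first apply: val_inj; rewrite insubdK.
rewrite /=; apply: eq_big => [s|s _]; first by rewrite (valP s).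
by rewrite (valP s) mul1r; apply: eq_bigr => k _; rewrite -pvalE.
Qed.

End Polarization.

Section TensorPower.
Local Open Scope ring_scope.
Local Open Scope complex_scope.
Local Open Scope sesquilinear_scope.
Variables (R : realType) (n d : nat).
Local Notation F := R[i].
Local Notation N := (tdim n d).
Local Notation V := (perm_factors_representation n d : mx_representation F [set: 'S_n]%G _).
Implicit Types (A B : 'M[F]_d).

Lemma big_word (f : {ffun 'I_n -> 'I_d} -> F) : \sum_(i < N) f (word i) = \sum_w f w.
Proof.
rewrite [RHS](reindex (fun i : 'I_N => word i)) //=.
by exists enum_rank => w _; rewrite /word ?enum_valK ?enum_rankK.
Qed.

Lemma tensor_powM A B : tensor_pow n (A *m B) = tensor_pow n A *m tensor_pow n B.
Proof.
apply/matrixP => i j; rewrite !mxE.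
under eq_bigr do rewrite mxE.
rewrite bigA_distr_bigA /= -big_word; apply: eq_bigr => l _.
by rewrite !mxE -big_split.
Qed.

Lemma tensor_pow_adj A : (tensor_pow n A)^t* = tensor_pow n (A^t* ).
Proof.
apply/matrixP => i j; rewrite !mxE rmorph_prod.
by apply: eq_bigr => k _; rewrite !mxE.
Qed.

Lemma tensor_pow1 : tensor_pow n (1%:M : 'M[F]_d) = 1%:M.
Proof.
apply/matrixP => i j; rewrite !mxE; under eq_bigr do rewrite mxE.
have [->|ne] := eqVneq; first by rewrite big1 // => k _; rewrite eqxx.
have [k nk] : exists k, word i k != word j k.
  apply: contrapT => no; case/eqP: ne; apply: enum_val_inj; apply/ffunP => k.
  by apply/eqP/negPn/negP => nk; apply: no; exists k.
by rewrite (bigD1 k) //= (negPf nk) mul0r.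
Qed.

Definition word_act (s : 'S_n) (i : 'I_N) : 'I_N :=
  enum_rank [ffun k => word i (s k)].

Lemma word_actE s i k : word (word_act s i) k = word i (s k).
Proof. by rewrite /word /word_act enum_rankK ffunE. Qed.

Lemma word_inj (i j : 'I_N) : (forall k, word i k = word j k) -> i = j.
Proof. by move=> h; apply: enum_val_inj; apply/ffunP. Qed.

Lemma word_actK s : cancel (word_act s) (word_act s^-1%g).
Proof. by move=> i; apply: word_inj => k; rewrite !word_actE permKV. Qed.

Lemma word_actKV s : cancel (word_act s^-1%g) (word_act s).
Proof. by move=> i; apply: word_inj => k; rewrite !word_actE permK. Qed.

Lemma perm_factorsE s i j : V s i j = (j == word_act s^-1%g i)%:R.
Proof.
rewrite mxE; congr (nat_of_bool _)%:R; rewrite -(inj_eq enum_val_inj).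
by rewrite /word_act enum_rankK.
Qed.

Lemma perm_cent_mxP (T : 'M[F]_N) :
  (forall s, T *m V s = V s *m T) <->
  (forall s i j, T (word_act s i) (word_act s j) = T i j).
Proof.
have L s i j : (V s *m T) i j = T (word_act s^-1%g i) j.
  rewrite mxE (bigD1 (word_act s^-1%g i)) //= big1 ?addr0 => [|l /negPf nl].
    by rewrite perm_factorsE eqxx mul1r.
  by rewrite perm_factorsE nl mul0r.
have Rt s i j : (T *m V s) i j = T i (word_act s j).
  rewrite mxE (bigD1 (word_act s j)) //= big1 ?addr0 => [|l /negPf nl].
    by rewrite perm_factorsE word_actK eqxx mulr1.
  rewrite perm_factorsE -(inj_eq (can_inj (word_actK s))) word_actKV eq_sym nl.
  by rewrite mulr0.
split=> [h s i j|h s].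
  by rewrite -Rt h L word_actK.
by apply/matrixP => i j; rewrite L Rt -[in LHS](word_actKV s i) h.
Qed.

Lemma tensor_pow_cent A s : tensor_pow n A *m V s = V s *m tensor_pow n A.
Proof.
move: s; apply/perm_cent_mxP => s i j; rewrite !mxE.
rewrite [RHS](reindex_inj (@perm_inj _ s)) /=.
by apply: eq_bigr => k _; rewrite !word_actE.
Qed.

(** The bilinear pairing, without conjugation: [Z] encodes an arbitrary linear functional, so that
    spanning is stated through annihilators. *)
Definition mx_pairing (Z T : 'M[F]_N) := \sum_i \sum_j T i j * Z i j.

(** Ryser's formula for matrix units writes the orbit sum of the unit at (i, j) as a signed
    combination of tensor powers, so [Z] sums to zero over every orbit. As [T] is constant on
    orbits, the order of S_n times the pairing regroups into such sums. *)
Lemma tensor_pow_span (Z : 'M[F]_N) :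
  (forall A, mx_pairing Z (tensor_pow n A) = 0) ->
  forall T : 'M[F]_N, (forall s, T *m V s = V s *m T) -> mx_pairing Z T = 0.
Proof.
move=> Z0 T /perm_cent_mxP cT.
have sym i j : \sum_(s : 'S_n) Z (word_act s i) (word_act s j) = 0.
  transitivity (\sum_(S : {set 'I_n}) (-1) ^+ (n - #|S|) *
    mx_pairing Z (tensor_pow n (\sum_(l in S) delta_mx (word i l) (word j l)))); last first.
    by rewrite big1 // => S _; rewrite Z0 mulr0.
  rewrite /mx_pairing.
  under [RHS]eq_bigr do rewrite mulr_sumr.
  rewrite [RHS]exchange_big /=.
  transitivity (\sum_(i' < N) \sum_(j' < N)
     (\sum_(s : 'S_n) \prod_k (delta_mx (word i (s k)) (word j (s k)) : 'M[F]_d) (word i' k) (word j' k)) * Z i' j').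
    under [RHS]eq_bigr => i' _ do under eq_bigr => j' _ do rewrite mulr_suml.
    under [RHS]eq_bigr do rewrite exchange_big /=.
    rewrite [RHS]exchange_big /=; apply: eq_bigr => s _.
    rewrite (bigD1 (word_act s i)) //= [X in _ + X]big1 ?addr0; last first.
      move=> i' ni; rewrite big1 // => j' _.
      have [k nk] : exists k, word i' k != word i (s k).
        apply: contrapT => no; case/eqP: ni; apply: word_inj => k; rewrite word_actE.
        by apply/eqP/negPn/negP => nk; apply: no; exists k.
      by rewrite (bigD1 k) //= mxE (negPf nk) !mul0r.
    rewrite (bigD1 (word_act s j)) //= [X in _ + X]big1 ?addr0; last first.
      move=> j' nj.
      have [k nk] : exists k, word j' k != word j (s k).
        apply: contrapT => no; case/eqP: nj; apply: word_inj => k; rewrite word_actE.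
        by apply/eqP/negPn/negP => nk; apply: no; exists k.
      by rewrite (bigD1 k) //= mxE (negPf nk) andbF !mul0r.
    by rewrite big1 ?mul1r // => k _; rewrite mxE !word_actE !eqxx.
  apply: eq_bigr => i' _.
  under [RHS]eq_bigr do rewrite mulr_sumr.
  rewrite [RHS]exchange_big /=; apply: eq_bigr => j' _.
  rewrite (polarization (fun l k => (delta_mx (word i l) (word j l) : 'M[F]_d) (word i' k) (word j' k))).
  rewrite mulr_suml; apply: eq_bigr => S _; rewrite -mulrA; congr (_ * (_ * _)).
  by rewrite mxE; apply: eq_bigr => k _; rewrite summxE.
suff : mx_pairing Z T *+ #|[set: 'S_n]%SET| = 0.
  move/eqP; rewrite -mulr_natr mulf_eq0 pnatr_eq0 -leqn0 leqNgt => /orP[/eqP //|].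
  by rewrite (cardD1 1%g) inE.
rewrite -sumr_const.
transitivity (\sum_(s : 'S_n) \sum_i \sum_j T i j * Z (word_act s i) (word_act s j)).
  rewrite [LHS](eq_bigl xpredT) => [|s]; last by rewrite inE.
  apply: eq_bigr => s _; rewrite /mx_pairing.
  rewrite (reindex_inj (can_inj (word_actK s))) /=; apply: eq_bigr => i _.
  rewrite (reindex_inj (can_inj (word_actK s))) /=; apply: eq_bigr => j _.
  by rewrite cT.
rewrite exchange_big big1 //= => i _; rewrite exchange_big big1 //= => j _.
by rewrite -mulr_sumr sym mulr0.
Qed.

(** The pairing is a polynomial in t with infinitely many roots. *)
Lemma tensor_pow_line (Z : 'M[F]_N) A B (z : nat -> F) : injective z ->
  (forall k, mx_pairing Z (tensor_pow n (A + z k *: B)) = 0) ->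
  forall t, mx_pairing Z (tensor_pow n (A + t *: B)) = 0.
Proof.
move=> z_inj hz.
pose p : {poly F} := \sum_i \sum_j
  (\prod_k ((A (word i k) (word j k))%:P + 'X * (B (word i k) (word j k))%:P)) * (Z i j)%:P.
have pE t : p.[t] = mx_pairing Z (tensor_pow n (A + t *: B)).
  rewrite /p /mx_pairing horner_sum; apply: eq_bigr => i _.
  rewrite horner_sum; apply: eq_bigr => j _; rewrite hornerM hornerC; congr (_ * _).
  rewrite horner_prod mxE; apply: eq_bigr => k _.
  by rewrite !mxE hornerD hornerM hornerX !hornerC.
suff p0 : p = 0 by move=> t; rewrite -pE p0 horner0.
apply/eqP; apply: contraT => /max_poly_roots h.
have := h [seq z k | k <- iota 0 (size p)].
rewrite (map_inj_uniq z_inj) iota_uniq size_map size_iota ltnn; apply=> //.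
by apply/allP => _ /mapP[k _ ->]; rewrite /root pE hz.
Qed.

End TensorPower.

(** * Polynomial continuation from unitary matrices *)

Section UnitaryDensity.
Local Open Scope ring_scope.
Local Open Scope sesquilinear_scope.
Variables (R : realType) (n d : nat).
Local Notation F := (complex R).
Local Notation N := (tdim n d).
Local Notation V := (perm_factors_representation n d : mx_representation F [set: 'S_n]%G _).

(** Commuting with [X] is thereby a family of linear conditions on T, to which continuation and
    spanning apply. *)
Lemma commutator_pairing (X : 'M[F]_N) i j :
  exists Z, forall T, mx_pairing Z T = (X *m T - T *m X) i j.
Proof.
exists (\matrix_(k, l) (X i k * (l == j)%:R - (k == i)%:R * X l j)) => T.
rewrite /mx_pairing !mxE.
under eq_bigr do under eq_bigr do rewrite mxE mulrBr.
under eq_bigr do rewrite sumrB.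
rewrite sumrB; congr (_ - _).
  apply: eq_bigr => k _; rewrite (bigD1 j) //= eqxx mulr1 big1 ?addr0 1?mulrC //.
  by move=> l /negPf ->; rewrite mulr0 mulr0.
rewrite (bigD1 i) //= [X in _ + X]big1 ?addr0.
  by apply: eq_bigr => l _; rewrite eqxx mul1r.
by move=> k /negPf ->; rewrite big1 // => l _; rewrite mul0r mulr0.
Qed.

(* The Cayley transform of the naturals: infinitely many points of the unit circle. *)
Definition cayley (k : nat) : F := (k%:R + 'i)%R / (k%:R - 'i)%R.

Lemma cayley_den (k : nat) : (k%:R - 'i)%R != 0 :> F.
Proof.
apply/eqP => e; have : (k%:R - 'i)%R * (k%:R + 'i)%R = 0 :> F by rewrite e mul0r.
rewrite -subr_sqr sqrCi opprK -natrX natr1 => /eqP.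
by rewrite pnatr_eq0.
Qed.

Lemma cayley_unimodular k : cayley k * (cayley k)^*%R = 1.
Proof.
have den' : (k%:R + 'i)%R != 0 :> F.
  have := cayley_den k; rewrite -conjC_eq0 rmorphB /= conjC_nat conjCi opprK //.
rewrite /cayley rmorphM /= fmorphV rmorphB rmorphD /= conjC_nat conjCi opprK.
by rewrite mulf_div [X in _ / X]mulrC divff // mulf_neq0 ?cayley_den.
Qed.

Lemma cayley_inj : injective cayley.
Proof.
move=> k l /eqP; rewrite /cayley eqr_div ?cayley_den // => /eqP e.
have : 2%:R * 'i%R * (l%:R - k%:R) = 0 :> F.
  transitivity ((k%:R + 'i) * (l%:R - 'i) - (l%:R + 'i) * (k%:R - 'i) : F)%R; last by rewrite e subrr.
  by ring.
move/eqP; rewrite !mulf_eq0 pnatr_eq0 /= (negPf (neq0Ci _)) /= subr_eq0 eqr_nat.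
by move/eqP.
Qed.

Section Vanishing.
Variable Z : 'M[F]_N.
Hypothesis Z_unitary : forall U : 'M[F]_d, U \is unitarymx ->
  mx_pairing Z (tensor_pow n U) = 0.

Lemma vanish_diag (P : 'M[F]_d) (x : 'rV[F]_d) : P \is unitarymx ->
  mx_pairing Z (tensor_pow n (P^t* *m diag_mx x *m P)) = 0.
Proof.
move=> uP.
(* Induction on the number m of leading eigenvalues left arbitrary, the others being unimodular. For
   m = 0 the matrix is unitary; each step frees one eigenvalue by continuation from the Cayley
   points. *)
suff H m (y : 'rV[F]_d) : (forall k : 'I_d, (m <= k)%N -> y 0 k * (y 0 k)^*%R = 1) ->
    mx_pairing Z (tensor_pow n (P^t* *m diag_mx y *m P)) = 0.
  by apply: (H d) => k; rewrite leqNgt ltn_ord.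
elim: m y => [|m IH] y hy.
  have uD : diag_mx y \is unitarymx.
    apply/unitarymxP; rewrite tr_diag_mx map_diag_mx mulmx_diag.
    by apply/matrixP => i j; rewrite !mxE hy.
  have uP' : P^t* \is unitarymx by exact: (etrans (trmxC_unitary P) uP).
  exact: Z_unitary (mul_unitarymx (mul_unitarymx uP' uD) uP).
have [ltm|gem] := ltnP m d; last first.
  by apply: IH => k lek; have := ltn_ord k; rewrite ltnNge (leq_trans gem lek).
pose k0 := Ordinal ltm.
pose upd t : 'rV[F]_d := \row_k (if k == k0 then t else y 0 k).
have updE t : diag_mx (upd t) = diag_mx (upd 0) + t *: delta_mx k0 k0.
  apply/matrixP => i j; rewrite !mxE.
  have [<-|ne] := eqVneq i j.
    by case: eqP => _ /=; rewrite ?mulr1n ?add0r ?mulr1 ?mulr0 ?addr0.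
  rewrite !mulr0n add0r; case: (eqVneq i k0) => [ei|]; rewrite ?mulr0 //.
  by rewrite -ei eq_sym (negPf ne) mulr0.
have updM t : P^t* *m diag_mx (upd t) *m P =
    P^t* *m diag_mx (upd 0) *m P + t *: (P^t* *m delta_mx k0 k0 *m P).
  by rewrite updE mulmxDr mulmxDl -scalemxAr -scalemxAl.
have -> : y = upd (y 0 k0).
  by apply/rowP => k; rewrite mxE; case: eqP => [->|].
rewrite updM; apply: (tensor_pow_line cayley_inj) => k; rewrite -updM; apply: IH => l lel.
rewrite mxE; case: eqP => [_|/eqP nl]; first exact: cayley_unimodular.
by apply: hy; rewrite ltn_neqAle lel andbT; apply: contraNneq nl => e; apply/eqP/val_inj.
Qed.

Lemma vanish_hermitian (A : 'M[F]_d) : A^t* = A -> mx_pairing Z (tensor_pow n A) = 0.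
Proof.
move=> hA; have /orthomx_spectralP -> : A \is normalmx by apply/normalmxP; rewrite hA.
by rewrite invmx_unitary ?spectral_unitarymx // vanish_diag ?spectral_unitarymx.
Qed.

(** Write A = H + iK with H and K Hermitian. The functional vanishes at the Hermitian matrices H +
    kK for natural k, and continuation reaches t = i. *)
Lemma vanish_all (A : 'M[F]_d) : mx_pairing Z (tensor_pow n A) = 0.
Proof.
pose H := 2%:R^-1 *: (A + A^t* ); pose K := (2%:R * 'i)^-1%R *: (A - A^t* ).
have two : 2%:R != 0 :> F by rewrite pnatr_eq0.
have two_i : (2%:R * 'i)%R != 0 :> F by rewrite mulf_neq0 ?neq0Ci.
have AE : A = H + 'i%R *: K.
  apply/matrixP => i j; rewrite !mxE; by field; rewrite ?two neq0Ci.
have hH : H^t* = H.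
  by apply/matrixP => i j; rewrite !mxE rmorphM rmorphD /= fmorphV rmorph_nat conjCK addrC.
have hK : K^t* = K.
  apply/matrixP => i j; rewrite !mxE rmorphM rmorphB /= fmorphV rmorphM rmorph_nat /= conjCi conjCK.
  by rewrite mulrN invrN mulNr -mulrN opprB.
rewrite AE; move: (H) (K) hH hK => H' K' hH hK {AE}.
apply: (@tensor_pow_line _ _ _ Z H' K' (fun k => k%:R)).
  by move=> k l /eqP; rewrite eqr_nat => /eqP.
move=> k; apply: vanish_hermitian.
have -> : (H' + k%:R *: K')^t* = H'^t* + k%:R *: K'^t*.
  by apply/matrixP => i j; rewrite !mxE !(rmorphD, rmorphM) /= rmorph_nat.
by rewrite hH hK.
Qed.

End Vanishing.

Lemma cent_unitary_cent (X : 'M[F]_N) :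
  (forall U : 'M[F]_d, U \is unitarymx -> X *m tensor_pow n U = tensor_pow n U *m X) ->
  forall T : 'M[F]_N, (forall s, T *m V s = V s *m T) -> X *m T = T *m X.
Proof.
move=> cX T cT; apply/eqP; rewrite -subr_eq0; apply/eqP/matrixP => i j.
have [Z hZ] := commutator_pairing X i j.
rewrite -hZ (tensor_pow_span _ cT) ?mxE // => A; apply: vanish_all => U uU.
by rewrite hZ cX // subrr mxE.
Qed.

End UnitaryDensity.

(** * Twirling *)

Section MinNorm.
Local Open Scope ring_scope.
Local Open Scope classical_set_scope.
Variables (R : realType) (T : finType).
Implicit Types u v w : T -> R.

Definition sqnorm u := \sum_t u t ^+ 2.

Lemma sqnorm_ge0 u : 0 <= sqnorm u.
Proof. by apply: sumr_ge0 => t _; exact: sqr_ge0. Qed.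

Lemma sqnorm_midpoint u v :
  sqnorm (fun t => u t - v t) =
  2 * sqnorm u + 2 * sqnorm v - 4 * sqnorm (fun t => (u t + v t) / 2).
Proof.
rewrite /sqnorm !mulr_sumr -big_split -sumrB; apply: eq_bigr => t _ /=; by field.
Qed.

(** The projection argument in a Hilbert space: by the parallelogram identity a minimizing sequence
    is Cauchy, so midpoints and sequential limits are the only closure properties called for. *)
Lemma sqnorm_min (C : set (T -> R)) : C !=set0 ->
  (forall u v, C u -> C v -> C (fun t => (u t + v t) / 2)) ->
  (forall (u : nat -> T -> R) v, (forall k, C (u k)) ->
     (forall t, u k t @[k --> \oo] --> v t) -> C v) ->
  exists2 v, C v & forall w, C w -> sqnorm v <= sqnorm w.
Proof.
move=> [u0 Cu0] Cmid Ccl.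
pose E := [set sqnorm w | w in C]; pose m := inf E.
have hE : has_inf E.
  by split; [exists (sqnorm u0), u0|exists 0 => _ [w _ <-]; exact: sqnorm_ge0].
have mle w : C w -> m <= sqnorm w by move=> Cw; apply: (ge_inf hE.2); exists w.
have /choice[u hu] : forall k : nat, exists w, C w /\ sqnorm w < m + k.+1%:R^-1.
  move=> k; have k0 : 0 < k.+1%:R^-1 :> R by rewrite invr_gt0.
  by have [_ [w Cw <-] lt] := inf_adherent k0 hE; exists w.
(* Twice the bounds m + 1/(j+1) and m + 1/(k+1), minus 4m for the midpoint, leave at most
   4/(k+1). *)
have near j k : (k <= j)%N -> sqnorm (fun t => u j t - u k t) <= 4 * k.+1%:R^-1.
  move=> lekj; rewrite sqnorm_midpoint.
  have := mle _ (Cmid _ _ (hu j).1 (hu k).1); have := (hu j).2; have := (hu k).2.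
  have : j.+1%:R^-1 <= k.+1%:R^-1 :> R by rewrite lef_pV2 ?posrE // ler_nat.
  move: (sqnorm _) (sqnorm _) (sqnorm _) (j.+1%:R^-1) (k.+1%:R^-1) => q1 q2 q3 a b; lra.
have cvgu t : cvg (u k t @[k --> \oo]).
  apply/cauchy_cvgP; apply: cauchy_exP => e e0.
  have [k _ hk] := near_infty_natSinv_lt (PosNum (divr_gt0 (exprn_gt0 2 e0) (ltr0n R 4))).
  exists (u k t); exists k => // j /= lekj; rewrite /ball /= distrC.
  have : (u j t - u k t) ^+ 2 < e ^+ 2.
    apply: (@le_lt_trans _ _ (4 * k.+1%:R^-1)); last first.
      by rewrite mulrC -ltr_pdivlMr //; exact: (hk k (leqnn k)).
    apply: le_trans (near j k lekj); rewrite /sqnorm (bigD1 t) //= lerDl.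
    by apply: sumr_ge0 => s _; exact: sqr_ge0.
  by rewrite -[X in X < _]real_normK ?num_real // ltr_pXn2r ?nnegrE // ltW.
pose v t := lim (u k t @[k --> \oo]).
have uv t : u k t @[k --> \oo] --> v t by exact: cvgu.
exists v; first by apply: (Ccl u) => // k; have [] := hu k.
move=> w Cw; apply: le_trans (mle _ Cw).
apply: (@ler_cvg_to _ (\oo) _ R (fun k => sqnorm (u k)) (fun k => m + k.+1%:R^-1)).
- rewrite /sqnorm; apply: cvg_big => [|t _]; first exact: add_continuous.
  by rewrite expr2; under eq_fun do rewrite expr2; apply: cvgM.
- rewrite -[X in _ --> X]addr0; apply: cvgD; first exact: cvg_cst.
  exact: cvg_harmonic.
- by near=> k; apply/ltW; have [] := hu k.
Unshelve. all: by end_near.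
Qed.

End MinNorm.

Section Traces.
Local Open Scope ring_scope.
Variables (C : comPzRingType) (m : nat).
Implicit Types G X H A : 'M[C]_m.

Lemma mxtrace_conj G X H A : \tr (G *m X *m H *m A) = \tr (X *m (H *m A *m G)).
Proof. by rewrite -!mulmxA mxtrace_mulC !mulmxA. Qed.

Lemma mxtrace_conj_mul G H X A : H *m G = 1%:M ->
  \tr (G *m X *m H *m (G *m (A *m H))) = \tr (X *m A).
Proof.
move=> HG; rewrite mxtrace_conj (mulmxA H) HG mul1mx -(mulmxA A) HG mulmx1 //.
Qed.

Lemma mxtrace_commutator X H A :
  \tr ((X *m H - H *m X) *m A) = \tr (X *m (H *m A - A *m H)).
Proof.
rewrite mulmxBl mulmxBr !linearB /= mulmxA; congr (_ - _).
by rewrite -mulmxA mxtrace_mulC mulmxA.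
Qed.

End Traces.

Section Twirl.
Local Open Scope ring_scope.
Local Open Scope classical_set_scope.
Local Open Scope sesquilinear_scope.
Variable R : realType.
Local Notation F := (complex R).

Section Coordinates.
Variable m : nat.
Implicit Types (X A : 'M[F]_m) (v : 'I_m * 'I_m * bool -> R).

(** The Boolean selects the imaginary part; in these real coordinates [sqnorm] is the squared
    Hilbert-Schmidt norm. *)
Definition mx_of_coord v : 'M[F]_m :=
  \matrix_(i, j) (v (i, j, false) +i* v (i, j, true))%C.

Definition coord_of_mx X : 'I_m * 'I_m * bool -> R :=
  fun t => if t.2 then complex.Im (X t.1.1 t.1.2) else complex.Re (X t.1.1 t.1.2).

Lemma coord_of_mxK X : mx_of_coord (coord_of_mx X) = X.
Proof. by apply/matrixP => i j; rewrite mxE /coord_of_mx /=; case: (X i j). Qed.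

Lemma big_coord (f : 'I_m * 'I_m * bool -> R) :
  \sum_t f t = \sum_i \sum_j (f (i, j, false) + f (i, j, true)).
Proof.
rewrite (eq_bigr (fun t => f (t.1, t.2))) => [|[]//].
rewrite -(pair_bigA _ (fun p b => f (p, b))) /=.
rewrite (eq_bigr (fun p => \sum_b f ((p.1, p.2), b))) => [|[]//].
rewrite -(pair_bigA _ (fun i j => \sum_b f ((i, j), b))) /=.
by apply: eq_bigr => i _; apply: eq_bigr => j _; rewrite big_bool addrC.
Qed.

Lemma Re_sum (I : Type) (r : seq I) (P : pred I) (f : I -> F) :
  complex.Re (\sum_(i <- r | P i) f i) = \sum_(i <- r | P i) complex.Re (f i).
Proof. by apply: (big_morph (@complex.Re R)) => // -[a b] [a' b']. Qed.

Lemma Re_tr_coord v A : complex.Re (\tr (mx_of_coord v *m A)) =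
  \sum_t v t * coord_of_mx (A^t* ) t.
Proof.
rewrite big_coord Re_sum; apply: eq_bigr => i _; rewrite mxE Re_sum.
apply: eq_bigr => j _; rewrite /coord_of_mx !mxE /=; case: (A j i) => a b /=.
by rewrite mulrN.
Qed.

Lemma sqnorm_coord X : sqnorm (coord_of_mx X) = complex.Re (\tr (X *m X^t* )).
Proof.
rewrite -{2}[X]coord_of_mxK Re_tr_coord trmxCK; apply: eq_bigr => -[[i j] b] _ /=.
by rewrite expr2.
Qed.

End Coordinates.

Variables (n d : nat) (rho : 'M[F]_d).
Local Notation N := (tdim n d).
Local Notation V := (perm_factors_representation n d : mx_representation F [set: 'S_n]%G _).
Local Notation rot U := (tensor_pow n (U *m rho *m U^t* )).

(** The closed convex hull of the orbit in dual form, as an intersection of closed half-spaces. *)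
Let hull : set ('I_N * 'I_N * bool -> R) := [set v | forall (A : 'M[F]_N) s,
  (forall U, U \is unitarymx -> complex.Re (\tr (rot U *m A)) <= s) ->
  complex.Re (\tr (mx_of_coord v *m A)) <= s].

Lemma rot_mul (U W : 'M[F]_d) : tensor_pow n W *m rot U *m (tensor_pow n W)^t* = rot (W *m U).
Proof. by rewrite tensor_pow_adj -!tensor_powM adjM !mulmxA. Qed.

Lemma twirl_exists : exists X : 'M[F]_N,
  (forall (A : 'M[F]_N) s,
    (forall U, U \is unitarymx -> complex.Re (\tr (rot U *m A)) <= s) ->
    complex.Re (\tr (X *m A)) <= s) /\
  (forall W : 'M[F]_d, W \is unitarymx -> X *m tensor_pow n W = tensor_pow n W *m X).
Proof.
have [||| v Cv vmin] := @sqnorm_min R _ hull.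
- exists (coord_of_mx (rot 1%:M)) => A s h; rewrite coord_of_mxK; apply: h.
  by apply/unitarymxP; rewrite mul1mx trmx1 map_mx1.
- move=> u v Cu Cv A s h; have := Cu A s h; have := Cv A s h.
  rewrite !Re_tr_coord => hv hu.
  apply: (@le_trans _ _ ((\sum_t u t * coord_of_mx (A^t* ) t +
    \sum_t v t * coord_of_mx (A^t* ) t) / 2)); last by lra.
  rewrite -big_split mulr_suml /= le_eqVlt; apply/orP; left; apply/eqP.
  by apply: eq_bigr => t _; rewrite mulrAC mulrDl.
- move=> u v Cu uv A s h.
  apply: (@ler_cvg_to _ (\oo) _ R (fun k => complex.Re (\tr (mx_of_coord (u k) *m A))) (fun=> s)).
  + rewrite Re_tr_coord; under eq_fun do rewrite Re_tr_coord.
    apply: cvg_big => [|t _]; first exact: add_continuous.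
    by apply: cvgM; [exact: uv|exact: cvg_cst].
  + exact: cvg_cst.
  + by near=> k; exact: Cu.
exists (mx_of_coord v); split=> [A s h|W uW]; first exact: Cv.
set X := mx_of_coord v; set G := tensor_pow n W.
have GG : G^t* *m G = 1%:M.
  rewrite /G tensor_pow_adj -tensor_powM.
  by rewrite -(invmx_unitary uW) mulVmx ?unitarymx_unit // tensor_pow1.
pose Y := G *m X *m G^t*.
have CY : hull (coord_of_mx Y).
  move=> A s h; rewrite coord_of_mxK /Y.
  rewrite mxtrace_conj; apply: Cv => U uU.
  have -> : \tr (rot U *m (G^t* *m A *m G)) = \tr (rot (W *m U) *m A).
    by rewrite -rot_mul mxtrace_conj.
  exact: h (mul_unitarymx uW uU).
have vX : v = coord_of_mx X.
  by apply/funext => -[[i j] []]; rewrite /coord_of_mx /= mxE.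
have qY : sqnorm (coord_of_mx Y) = sqnorm v.
  rewrite vX !sqnorm_coord /Y !adjM trmxCK; congr complex.Re.
  exact: mxtrace_conj_mul.
(* [Y] lies in the hull with the same norm as the minimizer [v]; minimality at their midpoint and
   the parallelogram identity make their distance zero. *)
have eYv : coord_of_mx Y = v.
  apply/funext => t; apply/eqP; rewrite -subr_eq0 -sqrf_eq0 eq_le sqr_ge0 andbT.
  have Cm : hull (fun t => (coord_of_mx Y t + v t) / 2).
    move=> A s h; have := CY A s h; have := Cv A s h.
    rewrite !Re_tr_coord => hv hu.
    apply: (@le_trans _ _ ((\sum_t coord_of_mx Y t * coord_of_mx (A^t* ) t +
      \sum_t v t * coord_of_mx (A^t* ) t) / 2)); last by lra.
    rewrite -big_split mulr_suml /= le_eqVlt; apply/orP; left; apply/eqP.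
    by apply: eq_bigr => t' _; rewrite mulrAC mulrDl.
  have := sqnorm_midpoint (coord_of_mx Y) v; have := vmin _ Cm; rewrite qY.
  move=> h1 h2; apply: (@le_trans _ _ (sqnorm (fun t => coord_of_mx Y t - v t))).
    rewrite /sqnorm (bigD1 t) //= lerDl; apply: sumr_ge0 => s _; exact: sqr_ge0.
  by rewrite h2; lra.
have e : Y = X by rewrite -[Y]coord_of_mxK eYv.
by rewrite -{1}e /Y -mulmxA GG mulmx1.
Unshelve. all: by end_near.
Qed.

End Twirl.

(** * Block projections and the twirled state *)

Section BlockProjections.
Local Open Scope ring_scope.
Local Open Scope sesquilinear_scope.
Variables (R : realType) (n d : nat).
Local Notation F := (complex R).
Local Notation N := (tdim n d).
Local Notation V := (perm_factors_representation n d : mx_representation F [set: 'S_n]%G _).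
Local Notation P lam := (block_projection R lam).
Implicit Types (lam : young n d) (T D : 'M[F]_N).

Lemma block_projection_adj lam : (P lam)^t* = P lam.
Proof.
by rewrite block_projectionE -[in RHS]block_op_herm; apply/matrixP => i j; rewrite !mxE.
Qed.

Lemma block_projection_idem lam : P lam *m P lam = P lam.
Proof. by rewrite block_projectionE -trmx_mul block_op_idem. Qed.

Lemma sum_block_projection : \sum_(lam : young n d) P lam = 1%:M.
Proof.
under eq_bigr do rewrite block_projectionE.
by rewrite -linear_sum /= block_op_sum trmx1.
Qed.

Lemma perm_cent_tr T : (forall s, T *m V s = V s *m T) -> forall s, T^T *m V s = V s *m T^T.
Proof.
move=> cT s; have := congr1 trmx (cT s^-1%g).
by rewrite !trmx_mul perm_factors_tr invgK => ->.
Qed.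

Lemma cent_block_projection lam T : (forall s, T *m V s = V s *m T) ->
  T *m P lam = P lam *m T.
Proof.
move=> /perm_cent_tr/(cent_block_op lam)/(congr1 trmx).
by rewrite !trmx_mul trmxK -block_projectionE => ->.
Qed.

Lemma tensor_pow_block_projection lam (A : 'M[F]_d) :
  tensor_pow n A *m P lam = P lam *m tensor_pow n A.
Proof. by apply: cent_block_projection => s; exact: tensor_pow_cent. Qed.

Lemma cent_scalar_block_projection lam (X : 'M[F]_N) :
  (forall s, X *m V s = V s *m X) ->
  (forall T, (forall s, T *m V s = V s *m T) -> X *m T = T *m X) ->
  exists c : F, X *m P lam = c *: P lam.
Proof.
move=> cX cXT; have [c hc] : exists c : F, block_op R lam *m X^T = c *: block_op R lam.
  apply: cent_scalar_block; first exact: perm_cent_tr.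
  move=> T /perm_cent_tr/cXT/(congr1 trmx).
  by rewrite !trmx_mul trmxK => ->.
exists c; apply: trmx_inj; rewrite trmx_mul block_projectionE trmxK hc.
by apply/matrixP => i j; rewrite !mxE.
Qed.

End BlockProjections.

Section Positivity.
Local Open Scope ring_scope.
Local Open Scope sesquilinear_scope.
Variables (R : realType) (m : nat).
Local Notation F := (complex R).
Implicit Types (S D : 'M[F]_m).

Lemma complex_ge0_Re (z : F) : 0 <= z -> 0 <= complex.Re z /\ z = (complex.Re z)%:C%C.
Proof. by case: z => a b; rewrite lecE /= => /andP[/eqP -> ->]. Qed.

(** States are handled as S S^*, so that a trace against D is a sum of quadratic forms, the
    quantities governed by positivity and by weak additivity. *)
Lemma tr_gram S D : \tr (S *m S^t* *m D) = \sum_i ((col i S)^t* *m D *m col i S) 0 0.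
Proof.
rewrite -mulmxA mxtrace_mulC; apply: eq_bigr => i _.
rewrite !mxE; apply: eq_bigr => l _; rewrite !mxE; congr (_ * _).
by apply: eq_bigr => k _; rewrite !mxE.
Qed.

Lemma tr_gram_ge0 S D : positive_operator D -> 0 <= \tr (S *m S^t* *m D).
Proof. by move=> pD; rewrite tr_gram; apply: sumr_ge0 => i _; exact: pD. Qed.

Lemma gram_Re_eq0 S : complex.Re (\tr (S *m S^t* )) = 0 -> S = 0.
Proof.
rewrite -sqnorm_coord /sqnorm => /eqP; rewrite psumr_eq0 => [/allP h|t _]; last exact: sqr_ge0.
apply/matrixP => i j; rewrite mxE; have hb b := h (i, j, b) (mem_index_enum _).
have := hb true; have := hb false; rewrite /coord_of_mx /= !sqrf_eq0.
by case: (S i j) => a b /= /eqP -> /eqP ->.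
Qed.

(** Presents the normalized trace against a projection in Gram form, to which the construction of
    measures from a POVM applies. *)
Lemma tr_scaled_projection (W D : 'M[F]_m) (r : R) : W^t* = W -> W *m W = W -> 0 < r ->
  let S := (Num.sqrt r^-1)%:C%C *: W in
  complex.Re (\tr (S *m S^t* *m D)) = complex.Re (\tr (W *m D)) / r.
Proof.
move=> adjW WW r0; set c := (Num.sqrt _)%:C%C => /=.
have cc : c * c^* = (r^-1)%:C%C :> F.
  apply/eqP; rewrite eq_complex /= oppr0 !mulr0 mul0r subr0 addr0 eqxx andbT.
  by rewrite -expr2 sqr_sqrtr // invr_ge0 ltW.
have -> : (c *: W) *m (c *: W)^t* = (r^-1)%:C%C *: W.
  by rewrite linearZ /= map_mxZ adjW -scalemxAl -scalemxAr WW scalerA cc.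
rewrite -scalemxAl linearZ /=; case: (\tr _) => a b /=.
by rewrite mul0r subr0 mulrC.
Qed.

Lemma positive_operator1 : positive_operator (1%:M : 'M[F]_m).
Proof.
move=> v; rewrite mulmx1 mxE; apply: sumr_ge0 => i _; rewrite !mxE mulrC.
exact: mul_conjC_ge0.
Qed.

End Positivity.

Section TwirlBlocks.
Local Open Scope ring_scope.
Local Open Scope sesquilinear_scope.
Variables (R : realType) (n d : nat).
Local Notation F := (complex R).
Local Notation N := (tdim n d).
Local Notation V := (perm_factors_representation n d : mx_representation F [set: 'S_n]%G _).
Local Notation P lam := (block_projection R lam).
Implicit Types (lam : young n d) (D : 'M[F]_N).

Lemma tr_block_ge0 lam D : positive_operator D -> 0 <= \tr (P lam *m D).
Proof.
by move=> pD; rewrite -block_projection_idem -{2}block_projection_adj; exact: tr_gram_ge0.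
Qed.

Lemma block_projection_positive lam : positive_operator (P lam).
Proof.
move=> v; have -> : (v^t* *m P lam *m v = (P lam *m v)^t* *m (P lam *m v))%R.
  by rewrite adjM block_projection_adj mulmxA -(mulmxA _ (P lam) (P lam)) block_projection_idem.
move: (P lam *m v) => u; rewrite mxE; apply: sumr_ge0 => i _; rewrite !mxE mulrC.
exact: mul_conjC_ge0.
Qed.

Lemma tr_block_projection_gt0 lam : P lam != 0 -> 0 < complex.Re (\tr (P lam)).
Proof.
move=> nz; have [ge0 _] := complex_ge0_Re (tr_block_ge0 lam (@positive_operator1 R N)).
rewrite mulmx1 in ge0; rewrite lt_neqAle ge0 andbT eq_sym; apply: contraNneq nz => e.
by apply/eqP/gram_Re_eq0; rewrite block_projection_adj block_projection_idem.
Qed.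

Lemma rot_diag_state_gram (th : d.-tuple R) (U : 'M[F]_d) :
  (forall i, 0 <= tnth th i) -> exists S : 'M[F]_N,
  tensor_pow n (U *m diag_state th *m U^t* ) = S *m S^t*.
Proof.
move=> th0; pose r : 'M[F]_d := diag_mx (\row_i (Num.sqrt (tnth th i))%:C%C).
exists (tensor_pow n (U *m r)); rewrite tensor_pow_adj -tensor_powM adjM; congr tensor_pow.
rewrite -!mulmxA; congr (_ *m _); rewrite mulmxA; congr (_ *m _).
rewrite /r tr_diag_mx map_diag_mx mulmx_diag /diag_state; congr diag_mx.
apply/rowP => i; rewrite !mxE; apply/eqP; rewrite eq_complex /=.
by rewrite oppr0 !mulr0 mul0r subr0 addr0 -expr2 sqr_sqrtr ?th0 ?eqxx.
Qed.

Lemma tr_rot_block (rho U : 'M[F]_d) lam : U \is unitarymx ->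
  \tr (tensor_pow n (U *m rho *m U^t* ) *m P lam) = \tr (tensor_pow n rho *m P lam).
Proof.
move=> uU; rewrite !tensor_powM mxtrace_conj (tensor_pow_block_projection lam (U^t* )).
by rewrite -(mulmxA (P lam)) -tensor_powM -(invmx_unitary uU) mulVmx ?unitarymx_unit // tensor_pow1 mulmx1.
Qed.

Lemma twirl_block_average (th : d.-tuple R) : exists X : 'M[F]_N,
  (forall (D : 'M[F]_N) s,
    (forall U : 'M[F]_d, U \is unitarymx ->
       complex.Re (\tr (tensor_pow n (U *m diag_state th *m U^t* ) *m D)) <= s) ->
    complex.Re (\tr (X *m D)) <= s) /\
  (forall D, positive_operator D ->
    complex.Re (\tr (X *m D)) =
    \sum_(lam : young n d) wss_law th lam *
       (complex.Re (\tr (P lam *m D)) / complex.Re (\tr (P lam)))).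
Proof.
have [X [hX cXU]] := twirl_exists n (diag_state th).
exists X; split=> // D pD.
have hX0 A : (forall U : 'M[F]_d, U \is unitarymx ->
     \tr (tensor_pow n (U *m diag_state th *m U^t* ) *m A) = 0) -> complex.Re (\tr (X *m A)) = 0.
  move=> h0; apply/eqP; rewrite eq_le; apply/andP; split.
    by apply: hX => U /h0 ->.
  rewrite -oppr_le0; have := hX (- A) 0; rewrite mulmxN linearN /=.
  have -> : complex.Re (- \tr (X *m A)) = - complex.Re (\tr (X *m A)) by case: (\tr _).
  by apply=> U /h0 e; rewrite mulmxN linearN /= e oppr0.
(* Tested against the adjoint of the commutator, the functional vanishes on the orbit because tensor
   powers commute with [V s]; hence the commutator has Hilbert-Schmidt norm zero. *)
have cXV s : X *m V s = V s *m X.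
  apply/eqP; rewrite -subr_eq0; apply/eqP/gram_Re_eq0.
  set B := _^t*.
  rewrite mxtrace_commutator; apply: hX0 => U uU.
  by rewrite -mxtrace_commutator tensor_pow_cent subrr mul0mx mxtrace0.
have cXT := cent_unitary_cent cXU.
have Xblock lam : complex.Re (\tr (X *m P lam *m D)) =
    wss_law th lam * (complex.Re (\tr (P lam *m D)) / complex.Re (\tr (P lam))).
  have [P0|nzP] := eqVneq (P lam) 0.
    by rewrite P0 mulmx0 !mul0mx linear0 /= mul0r mulr0.
  have [c hc] := cent_scalar_block_projection lam cXV cXT.
  have scalE (A : 'M[F]_N) : 0 <= \tr A -> complex.Re (\tr (c *: A)) = complex.Re c * complex.Re (\tr A).
    move=> /complex_ge0_Re[_ e]; rewrite linearZ /= e; case: c {hc} => a b /=.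
    by rewrite mulr0 subr0.
  rewrite hc -scalemxAl scalE ?tr_block_ge0 //.
  have trP := tr_block_projection_gt0 nzP.
  have -> : complex.Re c = wss_law th lam / complex.Re (\tr (P lam)).
    apply: (canRL (mulfK (lt0r_neq0 trP))); rewrite -scalE; last first.
      by have := tr_block_ge0 lam (@positive_operator1 R N); rewrite mulmx1.
    (* Every rotated state has the same weight on the block, so the bounds for [P lam] and its
       opposite fix the trace of [X] there. *)
    rewrite -hc; apply/eqP; rewrite eq_le; apply/andP; split.
      by apply: hX => U uU; rewrite tr_rot_block.
    rewrite -lerN2; have := hX (- P lam) (- wss_law th lam); rewrite mulmxN linearN /=.
    have ReN (z : F) : complex.Re (- z) = - complex.Re z by case: z.
    rewrite ReN; apply=> U uU; rewrite mulmxN linearN /= ReN tr_rot_block //.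
  by rewrite mulrAC mulrA.
rewrite -{1}[X]mulmx1 -(sum_block_projection R) mulmx_sumr mulmx_suml.
rewrite [\tr _](linear_sum (@mxtrace F N)) Re_sum.
by apply: eq_bigr => lam _; exact: Xblock.
Qed.

End TwirlBlocks.

(** * Measures and kernels *)

Section MeasureConstructions.
Local Open Scope classical_set_scope.
Local Open Scope ring_scope.
Local Open Scope ereal_scope.
Context {R : realType} {dA : measure_display} {A : measurableType dA}.

Import HBNNSimple.

(** The integral sees a set function only through level sets of simple functions, which are
    measurable. This allows [povm_law] to be replaced by a genuine measure. *)
Lemma integral_eq_on_measurable (mu nu : set A -> \bar R) (f : A -> \bar R) :
  (forall B, measurable B -> mu B = nu B) -> \int[mu]_x f x = \int[nu]_x f x.
Proof.
move=> e; have E (h : {nnsfun A >-> R}) : sintegral mu h = sintegral nu h.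
  by apply: eq_fsbigr => r _; rewrite e //; exact: measurable_sfunP.
rewrite /integral; congr (ereal_sup _ - ereal_sup _);
  by apply: eq_imagel => h _; exact: E.
Qed.

(* A POVM is constrained only on measurable sets, whereas a measure must be nonnegative
   everywhere. *)
Definition measurable_part (mu : set A -> \bar R) (mu0 : mu set0 = 0)
    (mu_ge0 : forall B, measurable B -> 0 <= mu B)
    (mu_sigma : forall F : (set A)^nat, (forall k, measurable (F k)) -> trivIset setT F ->
      (fun m => \sum_(0 <= k < m) mu (F k)) @ \oo --> mu (\bigcup_k F k)) : set A -> \bar R :=
  fun B => if pselect (measurable B) then mu B else 0.

Section MeasurablePart.
Variables (mu : set A -> \bar R) (mu0 : mu set0 = 0)
  (mu_ge0 : forall B, measurable B -> 0 <= mu B)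
  (mu_sigma : forall F : (set A)^nat, (forall k, measurable (F k)) -> trivIset setT F ->
    (fun m => \sum_(0 <= k < m) mu (F k)) @ \oo --> mu (\bigcup_k F k)).
Local Notation nu := (measurable_part mu0 mu_ge0 mu_sigma).

Lemma measurable_partE B : measurable B -> nu B = mu B.
Proof. by rewrite /measurable_part; case: pselect. Qed.

Let nu0 : nu set0 = 0. Proof. by rewrite measurable_partE. Qed.

Let nu_ge0 B : 0 <= nu B.
Proof. by rewrite /measurable_part; case: pselect => // mB; exact: mu_ge0. Qed.

Let nu_sigma : semi_sigma_additive nu.
Proof.
move=> F mF tF mUF; rewrite measurable_partE //.
under eq_fun do under eq_bigr do rewrite measurable_partE //.
exact: mu_sigma.
Qed.

HB.instance Definition _ := isMeasure.Build _ _ _ nu nu0 nu_ge0 nu_sigma.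

Lemma exists_measure : exists nu' : {measure set A -> \bar R},
  forall B, measurable B -> nu' B = mu B.
Proof. by exists [the {measure set A -> \bar R} of nu] => B mB; exact: measurable_partE. Qed.

End MeasurablePart.

Section Mixture.
Variables (I : finType) (w : I -> R) (m : I -> {measure set A -> \bar R}).
Hypothesis w0 : forall i, (0 <= w i)%R.

Lemma exists_mixture : exists2 nu : {measure set A -> \bar R},
  forall B, nu B = \sum_i (w i)%:E * m i B &
  forall f : A -> \bar R, (forall x, 0 <= f x) -> measurable_fun setT f ->
    \int[nu]_x f x = \sum_i (w i)%:E * \int[m i]_x f x.
Proof.
(* Sums of measures are indexed by naturals: [I] is enumerated and the sequence continued by the
   zero measure. *)
pose mk (k : nat) : {measure set A -> \bar R} :=
  if insub k is Some j then mscale (NngNum (w0 (enum_val (j : 'I_#|I|)))) (m (enum_val j))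
  else mzero.
have mkE (j : 'I_#|I|) : mk j = mscale (NngNum (w0 (enum_val j))) (m (enum_val j)).
  by rewrite /mk valK.
exists [the {measure set A -> \bar R} of msum mk #|I|] => [B|f f0 mf].
  rewrite /= /msum (big_enum_val (fun i => (w i)%:E * m i B)) /=.
  by apply: eq_bigr => j _; rewrite mkE.
rewrite ge0_integral_measure_sum //.
rewrite (big_enum_val (fun i => (w i)%:E * \int[m i]_x f x)) /=.
by apply: eq_bigr => j _; rewrite mkE ge0_integral_mscale.
Qed.

Lemma integral_mixture (nu : set A -> \bar R) (f : A -> \bar R) :
  (forall B, measurable B -> nu B = \sum_i (w i)%:E * m i B) ->
  (forall x, 0 <= f x) -> measurable_fun setT f ->
  \int[nu]_x f x = \sum_i (w i)%:E * \int[m i]_x f x.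
Proof.
move=> hnu f0 mf; have [nu' hnu' <-] := exists_mixture; [|by []..].
by apply: integral_eq_on_measurable => B mB; rewrite hnu.
Qed.

End Mixture.

Definition discrete_kernel d (X : measurableType d) (k : X -> {measure set A -> \bar R})
  (mX : forall U : set X, measurable U) (k1 : forall x, k x [set: A] = 1) := k.

Section DiscreteKernel.
Context d (X : measurableType d) (k : X -> {measure set A -> \bar R}).
Variables (mX : forall U : set X, measurable U) (k1 : forall x, k x [set: A] = 1).
Local Notation K := (discrete_kernel mX k1).

Let measurable_discrete_kernel U : measurable U -> measurable_fun [set: X] (K ^~ U).
Proof. by move=> mU _ Y mY; exact: mX. Qed.

HB.instance Definition _ := isKernel.Build _ _ _ _ _ K measurable_discrete_kernel.
HB.instance Definition _ := Kernel_isProbability.Build _ _ _ _ _ K k1.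

Lemma exists_kernel : exists delta : R.-pker X ~> A, forall x B, delta x B = k x B.
Proof. by exists [the R.-pker X ~> A of K]. Qed.

End DiscreteKernel.

End MeasureConstructions.

Section ComplexLimits.
Local Open Scope classical_set_scope.
Local Open Scope ring_scope.
Variable R : realType.
Local Notation F := (complex R).

Lemma cvg_Re (z : nat -> F) (l : F) :
  (z k : F^o) @[k --> \oo] --> (l : F^o) -> complex.Re (z k) @[k --> \oo] --> complex.Re l.
Proof.
move=> zl; apply/cvgrPdist_lt => e e0.
have e0' : 0 < e%:C%C :> F by rewrite ltcR.
near=> k.
have h : `|l - z k| < e%:C%C by near: k; exact: (@cvgrPdist_lt _ F^o _ _ _ _ _).1 zl _ e0'.
rewrite -ltcR; apply: le_lt_trans h.
by have := normc_ge_Re (l - z k); case: (l) (z k) => a b [a' b'].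
Unshelve. all: by end_near.
Qed.

Lemma cvg_realC (r : nat -> R) (l : R) :
  r k @[k --> \oo] --> l -> ((r k)%:C%C : F^o) @[k --> \oo] --> (l%:C%C : F^o).
Proof.
move=> rl; apply/cvgrPdist_lt => -[e e1] /=; rewrite ltcE /= => /andP[/eqP -> e0].
near=> k.
have h : `|l - r k| < e by near: k; exact: (@cvgrPdist_lt R R _ _ _ _ _).1 rl _ e0.
by rewrite -rmorphB /= normc_def /= expr0n /= addr0 sqrtr_sqr ltcR.
Unshelve. all: by end_near.
Qed.

End ComplexLimits.

(** * Scalar measures attached to a POVM *)

Section POVMMeasures.
Local Open Scope classical_set_scope.
Local Open Scope ring_scope.
Local Open Scope sesquilinear_scope.
Context {R : realType} {dA : measure_display} {A : measurableType dA}.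
Variables (m : nat) (D : set A -> 'M[complex R]_m).
Hypothesis povmD : is_povm D.
Local Notation F := (complex R).

Let g (S : 'M[F]_m) B := complex.Re (\tr (S *m S^t* *m D B)).

Lemma gram_sigma S (E : (set A)^nat) : (forall k, measurable (E k)) -> trivIset setT E ->
  (\sum_(0 <= k < p) g S (E k)) @[p --> \oo] --> g S (\bigcup_k E k).
Proof.
move=> mE tE; rewrite /g.
under eq_fun do rewrite big_mkord -Re_sum.
apply: (@cvg_Re R (fun p => \sum_(k < p) \tr (S *m S^t* *m D (E k)))).
have -> : (fun p => \sum_(k < p) \tr (S *m S^t* *m D (E k))) =
    (fun p => \sum_i \sum_(k < p) ((col i S)^t* *m D (E k) *m col i S) 0 0).
  apply/funext => p; rewrite [RHS]exchange_big; apply: eq_bigr => k _; exact: tr_gram.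
rewrite tr_gram.
apply: cvg_big => [|i _]; first exact: add_continuous.
have [_ _ +] := povmD; apply => //.
Qed.

(** Additivity along the constant sequence of empty sets makes the partial sums converge; their
    constant increment is therefore zero. *)
Lemma gram_set0 S : g S set0 = 0.
Proof.
have h := @gram_sigma S (fun=> set0) (fun=> measurable0) (@trivIset_set0 _ _ _).
rewrite bigcup0 // in h.
have h' := h; rewrite -(cvg_shiftS (fun p => \sum_(0 <= k < p) g S set0)) /= in h'.
have hc := cvgB h' h.
have e : (fun p : nat => \sum_(0 <= k < p.+1) g S set0) - (fun p => \sum_(0 <= k < p) g S set0) =
   cst (g S set0).
  by apply/funext => p /=; rewrite !fctE big_nat_recr //= addrAC subrr add0r.
rewrite e subrr in hc.
have {}hc : cst (g S set0) x @[x --> \oo] --> (0 : R) by apply: hc.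
rewrite -(cvg_lim (@Rhausdorff R) hc).
by rewrite (cvg_lim (@Rhausdorff R) (cvg_cst _)).
Qed.

Lemma povm_gram_measure (S : 'M[F]_m) : exists mu : {measure set A -> \bar R},
  forall B, measurable B -> mu B = (complex.Re (\tr (S *m S^t* *m D B)))%:E.
Proof.
apply: (@exists_measure _ _ _ (fun B => (g S B)%:E)).
- by rewrite gram_set0.
- move=> B mB; rewrite lee_fin; have [pD _ _] := povmD.
  by have [] := complex_ge0_Re (tr_gram_ge0 S (pD B mB)).
- move=> E mE tE; under eq_fun do rewrite sumEFin.
  by apply: cvg_EFin; [near=> p|exact: gram_sigma].
Unshelve. all: by end_near.
Qed.

End POVMMeasures.

(** * Comparison of the two risks *)

Section LossSections.
Local Open Scope classical_set_scope.
Local Open Scope ring_scope.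
Variable R : realType.

(** The loss is measurable on the simplex times the action space, so measurability of its sections
    rests on that of the simplex. *)
Lemma measurable_ordered_simplex d : measurable (ordered_simplex R d).
Proof.
have mt i : measurable_fun [set: d.-tuple R] (fun th => tnth th i).
  exact: measurable_tnth.
have mpre (g : d.-tuple R -> R) (Y : set R) : measurable_fun setT g -> measurable Y ->
    measurable (g @^-1` Y).
  by move=> mg mY; rewrite -[X in measurable X]setTI; exact: mg.
have -> : ordered_simplex R d =
  (\bigcap_(i in [set: 'I_d]) ((fun th => tnth th i) @^-1` `[0, 1])) `&`
  (\bigcap_(p in [set: 'I_d * 'I_d])
     [set th | (p.1 <= p.2)%N -> tnth th p.2 <= tnth th p.1]) `&`
  ((fun th => \sum_(i < d) tnth th i) @^-1` [set 1]).
  apply/seteqP; split=> th /=.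
    move=> [h1 h2 h3]; split=> //; split=> [i _|[i j] _] /=; last exact: h2.
    by rewrite in_itv /= h1.
  move=> [[h1 h2] h3]; split=> // [i|i j]; last exact: (h2 (i, j)).
  by have := h1 i I; rewrite /= in_itv.
apply: measurableI; first apply: measurableI.
- apply: fin_bigcap_measurable => [|i _]; first exact: finite_finset.
  by apply: mpre => //; exact: measurable_itv.
- apply: fin_bigcap_measurable => [|[i j] _]; first exact: finite_finset.
  rewrite /=; case: (i <= j)%N; last first.
    by rewrite (_ : [set _ | _] = setT) //; apply/seteqP; split.
  have -> : [set th : d.-tuple R | true -> tnth th j <= tnth th i] =
      (fun th => tnth th i - tnth th j) @^-1` `[0, +oo[.
    apply/seteqP; split=> th /=; rewrite in_itv /= andbT subr_ge0 //; exact.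
  by apply: mpre; [exact: measurable_funB|exact: measurable_itv].
- by apply: mpre; [exact: measurable_sum|exact: measurable_set1].
Qed.

Lemma measurable_loss_section d (dA : measure_display) (A : measurableType dA)
    (l : d.-tuple R * A -> \bar R) th :
  measurable_fun (ordered_simplex R d `*` [set: A]) l -> ordered_simplex R d th ->
  measurable_fun setT (fun a => l (th, a)).
Proof.
move=> ml hth _ Y mY; rewrite setTI.
have mD : measurable (ordered_simplex R d `*` [set: A]).
  by apply: measurableX => //; exact: measurable_ordered_simplex.
have -> : (fun a => l (th, a)) @^-1` Y =
    (pair th) @^-1` (ordered_simplex R d `*` [set: A] `&` l @^-1` Y).
  by apply/seteqP; split=> a /=; [split|case].
by rewrite -[X in measurable X]setTI; apply: pair1_measurable => //; exact: ml.
Qed.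

End LossSections.

Section SimpleFunctions.
Local Open Scope classical_set_scope.
Local Open Scope ring_scope.
Context {R : realType} {dA : measure_display} {A : measurableType dA}.
Import HBNNSimple.

(** One operator [L], the values of [h] weighted by [D] on its level sets, serves every state [M]. A
    bound on all rotated states can thus be passed to the twirled state. *)
Lemma sintegral_tr m (D : set A -> 'M[complex R]_m) (h : {nnsfun A >-> R}) :
  exists L : 'M[complex R]_m, forall (M : 'M[complex R]_m) (nu : {measure set A -> \bar R}),
    (forall B, measurable B -> nu B = (complex.Re (\tr (M *m D B)))%:E) ->
    sintegral nu h = (complex.Re (\tr (M *m L)))%:E.
Proof.
exists (\sum_(x <- finmap.enum_fset (fset_set (range h))) x%:C%C *: D (h @^-1` [set x])).
move=> M nu hnu; rewrite sintegralE fsbig_finite //=.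
rewrite mulmx_sumr (linear_sum (@mxtrace (complex R) m)) /= Re_sum -sumEFin.
apply: eq_bigr => x _; rewrite hnu; last exact: measurable_sfunP.
by rewrite -scalemxAr linearZ /= -EFinM; case: (\tr _) => a b /=; rewrite mul0r subr0.
Qed.

End SimpleFunctions.

Section RiskComparison.
Local Open Scope classical_set_scope.
Local Open Scope ring_scope.
Local Open Scope ereal_scope.
Local Open Scope sesquilinear_scope.
Context {R : realType} {dA : measure_display} {A : measurableType dA}.
Variables (n d : nat).
Local Notation F := (complex R).
Local Notation N := (tdim n d.+1).
Local Notation P lam := (block_projection R lam).
Import HBNNSimple.
Local Notation rot th U := (tensor_pow n (U *m diag_state th *m U^t* )%R).

Lemma simplex_ge0 (th : d.+1.-tuple R) : ordered_simplex R d.+1 th ->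
  forall i, (0 <= tnth th i)%R.
Proof. by move=> [h _ _] i; have /andP[] := h i. Qed.

Lemma unitarymx1 : (1%:M : 'M[F]_d.+1)%R \is unitarymx.
Proof. by apply/unitarymxP; rewrite mul1mx trmx1 map_mx1. Qed.

Lemma wss_law_ge0 (th : d.+1.-tuple R) (lam : young n d.+1) :
  ordered_simplex R d.+1 th -> (0 <= wss_law th lam)%R.
Proof.
move=> /simplex_ge0 th0; rewrite /wss_law -(tr_rot_block _ lam unitarymx1).
have [S ->] := rot_diag_state_gram n 1%:M%R th0.
by have [] := complex_ge0_Re (tr_gram_ge0 S (block_projection_positive lam)).
Qed.

Section POVM.
Variables (D : set A -> 'M[F]_N) (povmD : is_povm D).

Lemma povm_law_measure (th : d.+1.-tuple R) (U : 'M[F]_d.+1) :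
  ordered_simplex R d.+1 th -> exists mu : {measure set A -> \bar R},
  forall B, measurable B -> mu B = povm_law D (rot th U) B.
Proof.
move=> /simplex_ge0 th0; have [S eS] := rot_diag_state_gram n U th0.
have [mu hmu] := povm_gram_measure povmD S.
by exists mu => B mB; rewrite hmu // /povm_law eS.
Qed.

(** One kernel serves every [th]: although the twirled state depends on [th], the normalized outcome
    law of each block does not, and [th] enters only through the weights. *)
Lemma block_outcome_kernel : exists delta : R.-pker (young n d.+1) ~> A,
  forall (th : d.+1.-tuple R) (f : A -> \bar R),
  ordered_simplex R d.+1 th -> (forall a, 0 <= f a) -> measurable_fun setT f ->
  \sum_lam (wss_law th lam)%:E * \int[delta lam]_a f a <=
  ereal_sup [set \int[povm_law D (rot th U)]_a f a
    | U in [set U : 'M[F]_d.+1 | U \is unitarymx]].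
Proof.
have N_gt0 : (0 < N)%N by rewrite card_ffun !card_ord expn_gt0.
(* An empty block has trace 0 and cannot be normalized; its outcome law is irrelevant, and
   the identity serves in its place. *)
have /choice[W hW] : forall lam : young n d.+1, exists W : 'M[F]_N,
    [/\ W^t* = W, (W *m W = W)%R, (0 < complex.Re (\tr W))%R & P lam != 0%R -> W = P lam].
  move=> lam; have [P0|nzP] := eqVneq (P lam) 0%R; last first.
    exists (P lam); split=> //; first exact: block_projection_adj.
      exact: block_projection_idem.
    exact: tr_block_projection_gt0.
  exists 1%:M%R; split=> //; rewrite ?trmx1 ?map_mx1 ?mul1mx // mxtrace1.
  by rewrite -(rmorph_nat (real_complex R)) /= ltr0n.
have /choice[mu hmu] : forall lam, exists mu : {measure set A -> \bar R},
    forall B, measurable B ->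
    mu B = (complex.Re (\tr (W lam *m D B)) / complex.Re (\tr (W lam)))%:E.
  move=> lam; have [adjW WW trW _] := hW lam.
  have [mu hmu] := povm_gram_measure povmD ((Num.sqrt (complex.Re (\tr (W lam)))^-1)%:C%C *: W lam)%R.
  by exists mu => B /hmu ->; rewrite tr_scaled_projection.
have mu1 lam : mu lam [set: A] = 1.
  have [_ _ trW _] := hW lam; rewrite hmu //; have [_ -> _] := povmD.
  by rewrite mulmx1 divff // gt_eqF.
have [|delta hdelta] := @exists_kernel _ _ _ _ (young n d.+1) mu _ mu1; first by [].
exists delta => th f hth f0 mf; set s := ereal_sup _.
have w0 (lam : young n d.+1) : (0 <= wss_law th lam)%R by exact: wss_law_ge0.
have [X [hX hXD]] := twirl_block_average n th.
have [nu hnu hint] := exists_mixture (fun lam => delta lam) w0.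
rewrite -(hint f f0 mf).
(* The mixture of block laws with the sampling weights is the outcome law of [X]; a block with zero
   projection has weight zero. *)
have hnuX B : measurable B -> nu B = (complex.Re (\tr (X *m D B)))%:E.
  move=> mB; have [pD _ _] := povmD; rewrite hnu (hXD _ (pD B mB)) -sumEFin.
  apply: eq_bigr => lam _; rewrite hdelta hmu // -EFinM; congr (_%:E).
  have [_ _ _ hWP] := hW lam; have [P0|/hWP -> //] := eqVneq (P lam) 0%R.
  by rewrite /wss_law P0 mulmx0 linear0 /= !mul0r.
rewrite ge0_integralTE //; apply: ge_ereal_sup => _ [h hf <-].
have [L hL] := sintegral_tr D h; rewrite (hL X nu hnuX).
have lawU U : U \is unitarymx -> (complex.Re (\tr (rot th U *m L)))%:E <= s /\ 0 <= s.
  move=> uU; have [m hm] := povm_law_measure U hth.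
  have le_s : \int[m]_a f a <= s.
    apply: ereal_sup_ubound; exists U => //.
    by apply: integral_eq_on_measurable => B /hm ->.
  split; last by apply: le_trans le_s; exact: integral_ge0.
  rewrite -(hL _ m hm) -integralT_nnsfun; apply: le_trans le_s.
  apply: ge0_le_integral => //; first by move=> x _; rewrite lee_fin; exact: fun_ge0.
  exact/measurable_EFinP.
(* The identity shows that [s] is nonnegative, which excludes [-oo]. The case [+oo] is trivial, and
   a finite [s] is a bound to which [hX] applies. *)
have [_ s0] := lawU _ unitarymx1.
case: s s0 lawU => [r| |] // s0 lawU; last exact: leey.
by rewrite lee_fin; apply: hX => U uU; have [] := lawU U uU; rewrite lee_fin.
Qed.

End POVM.

End RiskComparison.

(** * From kernels to POVMs *)

Section KernelPOVM.
Local Open Scope classical_set_scope.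
Local Open Scope ring_scope.
Local Open Scope sesquilinear_scope.
Context {R : realType} {dA : measure_display} {A : measurableType dA}.
Variables (n d : nat) (delta : R.-pker (young n d.+1) ~> A).
Local Notation F := (complex R).
Local Notation N := (tdim n d.+1).
Local Notation P lam := (block_projection R lam).

Definition kernel_povm (B : set A) : 'M[F]_N :=
  \sum_(lam : young n d.+1) (fine (delta lam B))%:C%C *: P lam.

Lemma kernel_fin_num lam B : measurable B -> delta lam B \is a fin_num.
Proof. by move=> mB; apply: kernel_finite_transition. Qed.

Lemma kernel_povm_form (u v : 'cV[F]_N) B :
  (u^t* *m kernel_povm B *m v) 0 0 =
  \sum_(lam : young n d.+1) (fine (delta lam B))%:C%C * (u^t* *m P lam *m v) 0 0.
Proof.
rewrite /kernel_povm mulmx_sumr mulmx_suml summxE; apply: eq_bigr => lam _.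
by rewrite -scalemxAr -scalemxAl mxE.
Qed.

Lemma is_povm_kernel_povm : is_povm kernel_povm.
Proof.
split=> [B mB v||E mE tE u v].
- rewrite kernel_povm_form; apply: sumr_ge0 => lam _; apply: mulr_ge0.
    by rewrite lecR fine_ge0.
  exact: block_projection_positive.
- rewrite -(sum_block_projection R n d.+1); apply: eq_bigr => lam _.
  by rewrite prob_kernel /= scale1r.
- rewrite kernel_povm_form.
  have -> : (fun p => \sum_(k < p) (u^t* *m kernel_povm (E k) *m v) 0 0 : F^o) =
    (fun p => \sum_(lam : young n d.+1)
       (\sum_(k < p) fine (delta lam (E k)))%:C%C * (u^t* *m P lam *m v) 0 0).
    apply/funext => p; under eq_bigr do rewrite kernel_povm_form.
    rewrite exchange_big; apply: eq_bigr => lam _.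
    by rewrite -mulr_suml rmorph_sum.
  apply: cvg_big => [|lam _]; first exact: add_continuous.
  apply: (@cvgM F _ \oo); last exact: cvg_cst.
  apply: cvg_realC.
  have mU : measurable (\bigcup_k E k) by exact: bigcup_measurable.
  have := @measure_sigma_additive _ _ _ (delta lam) E mE tE.
  rewrite -(fineK (kernel_fin_num lam mU)) => /fine_cvg h.
  have e : (fun p => \sum_(k < p) fine (delta lam (E k))) =
      fine \o (fun p => (\sum_(0 <= k < p) delta lam (E k))%E).
    apply/funext => p /=; rewrite big_mkord.
    under [in RHS]eq_bigr => k _ do rewrite -(fineK (kernel_fin_num lam (mE k))).
    by rewrite sumEFin.
  by rewrite e.
Qed.

Lemma integral_povm_law_kernel (th : d.+1.-tuple R) (U : 'M[F]_d.+1) (f : A -> \bar R) :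
  ordered_simplex R d.+1 th -> U \is unitarymx -> (forall a, (0 <= f a)%E) ->
  measurable_fun setT f ->
  (\int[povm_law kernel_povm (tensor_pow n (U *m diag_state th *m U^t* ))]_a f a =
   \sum_(lam : young n d.+1) (wss_law th lam)%:E * \int[delta lam]_a f a)%E.
Proof.
move=> hth uU f0 mf; apply: integral_mixture => // [lam|B mB]; first exact: wss_law_ge0.
rewrite /povm_law /kernel_povm mulmx_sumr (linear_sum (@mxtrace F N)) /= Re_sum -sumEFin.
apply: eq_bigr => lam _.
rewrite -{2}(fineK (kernel_fin_num lam mB)) -EFinM; congr (_%:E).
rewrite -scalemxAr linearZ /= (tr_rot_block _ lam uU) /wss_law.
by case: (\tr _) => a b /=; rewrite mul0r subr0 mulrC.
Qed.

End KernelPOVM.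

Local Open Scope classical_set_scope.
Local Open Scope ring_scope.

Theorem theorem5p6 (R : realType) (n d : nat) (n_ge1 : (1 <= n)%N)
    (dA : measure_display) (A : measurableType dA)
    (A_borel : standard_borel R A)
    (K : set (d.+1.-tuple R))
    (K_nonempty : K !=set0) (K_simplex : K `<=` ordered_simplex R d.+1)
    (l : d.+1.-tuple R * A -> \bar R)
    (l_ge0 : forall th a, ordered_simplex R d.+1 th -> (0 <= l (th, a))%E)
    (l_meas : measurable_fun (ordered_simplex R d.+1 `*` [set: A]) l) :
  risk_all n K l = risk_wss n K l.

Proof.
have mls th (hth : K th) : measurable_fun setT (fun a => l (th, a)).
  by apply: measurable_loss_section => //; exact: K_simplex.
have l0 th (hth : K th) a : (0 <= l (th, a))%E by apply: l_ge0; exact: K_simplex.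
apply/eqP; rewrite eq_le; apply/andP; split; apply: le_ereal_inf_tmp.
  move=> _ [delta _ <-]; apply: ge_ereal_inf.
  exists (ereal_sup [set ereal_sup [set
      (\int[povm_law (kernel_povm delta)
         (tensor_pow n (U *m diag_state th *m (map_mx Num.conj U^T)))]_a l (th, a))%E
      | U in [set U : 'M[complex R]_d.+1 | U \is unitarymx]] | th in K]).
    by exists (kernel_povm delta) => //; exact: is_povm_kernel_povm.
  apply: ge_ereal_sup => _ [th hth <-]; apply: ge_ereal_sup => _ [U uU <-].
  rewrite integral_povm_law_kernel //; [|exact: K_simplex|exact: l0|exact: mls].
  by apply: ereal_sup_ubound; exists th.
move=> _ [D povmD <-]; have [delta hdelta] := block_outcome_kernel povmD.
apply: ge_ereal_inf; eexists; first by exists delta.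
apply: ge_ereal_sup => _ [th hth <-].
apply: le_trans (hdelta th _ (K_simplex _ hth) (l0 th hth) (mls th hth)) _.
by apply: ereal_sup_ubound; exists th.
Qed.
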